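(* There is an absolute constant $K_3>0$ such that the following holds. Let $r=r(n)>0$ satisfy $r \leq K_3 \log n / \sqrt{n}$ and let $G \in \mathcal{G}(n,r)$. Then $c(G) > 1$ with probability tending to $1$ as $n\to\infty$.
   Context: $\mathcal{G}(n,r)$ denotes the random geometric graph $G(x_1,\dots,x_n;r)$ where $x_1,\dots,x_n$ are chosen independently and uniformly at random from $[0,1]^2$, and $x_i,x_j$ ($i\ne j$) are adjacent iff $\|x_i-x_j\|\le r$. Game of cops and robbers on a finite graph: cops choose starting vertices, then the robber; players alternate turns, each agent moving to an adjacent vertex or staying put (cops move simultaneously; full information); cops win if some cop eventually occupies the robber's vertex. The cop number $c(G)$ is the minimum number of cops having a strategy that wins against every robber strategy (for a disconnected graph with at least two vertices one cop cannot win). *)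

(* Defs.v *)
From Stdlib Require Import Reals Lra Lia List.
Import ListNotations.
Open Scope R_scope.

Definition dist2 (p q : R * R) : R :=
  sqrt ((fst p - fst q) ^ 2 + (snd p - snd q) ^ 2).

Definition vert (n : nat) (v : nat) : Prop := (v < n)%nat.

Definition rgg_adj (n : nat) (x : nat -> R * R) (r : R) (u v : nat) : Prop :=
  (u < n)%nat /\ (v < n)%nat /\ u <> v /\ dist2 (x u) (x v) <= r.

Definition step (V : nat -> Prop) (adj : nat -> nat -> Prop) (u v : nat) : Prop :=
  V v /\ (u = v \/ adj u v).

(* cops_win_from V adj cs r : the cops at positions cs (one entry per cop),
   with the cops to move and the robber at r, can force a capture in finitely
   many moves (least fixed point = winning strategy against every robber). *)
Inductive cops_win_from (V : nat -> Prop) (adj : nat -> nat -> Prop)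
  : list nat -> nat -> Prop :=
| cwf_move : forall cs r cs',
    Forall2 (step V adj) cs cs' ->
    (In r cs' \/
     (forall r', step V adj r r' -> In r' cs' \/ cops_win_from V adj cs' r')) ->
    cops_win_from V adj cs r.

Definition k_cops_win (V : nat -> Prop) (adj : nat -> nat -> Prop) (k : nat) : Prop :=
  exists cs : list nat,
    length cs = k /\ Forall V cs /\
    (forall r, V r -> In r cs \/ cops_win_from V adj cs r).

Definition cop_number_gt1 (V : nat -> Prop) (adj : nat -> nat -> Prop) : Prop :=
  forall k, k_cops_win V adj k -> (1 < k)%nat.

(** * Probability for n i.i.d. uniform points of [0,1]^2 (inner Jordan content) *)

(* a grid cell of mesh 1/m in ([0,1]^2)^n : a list of n pairs (a,b) with a,b < m,
   representing the product of the closed squares [a/m,(a+1)/m] x [b/m,(b+1)/m] *)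
Definition valid_cell (n m : nat) (c : list (nat * nat)) : Prop :=
  length c = n /\ Forall (fun ab => (fst ab < m)%nat /\ (snd ab < m)%nat) c.

Definition in_cell (n m : nat) (c : list (nat * nat)) (x : nat -> R * R) : Prop :=
  forall i, (i < n)%nat ->
    let ab := nth i c (0%nat, 0%nat) in
    INR (fst ab) / INR m <= fst (x i) <= INR (S (fst ab)) / INR m /\
    INR (snd ab) / INR m <= snd (x i) <= INR (S (snd ab)) / INR m.

(* prob_ge n E p : the event E (about x_0,...,x_{n-1} uniform in [0,1]^2)
   has probability at least p, witnessed by finitely many grid cells
   contained in E of total volume >= p. *)
Definition prob_ge (n : nat) (E : (nat -> R * R) -> Prop) (p : R) : Prop :=
  exists (m : nat) (L : list (list (nat * nat))),
    (0 < m)%nat /\ NoDup L /\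
    Forall (fun c => valid_cell n m c /\ forall x, in_cell n m c x -> E x) L /\
    INR (length L) / (INR m) ^ (2 * n) >= p.

(* Main.v *)
Require Import Defs.
From Stdlib Require Import Reals List Lia Lra ZArith.
From mathcomp Require all_boot.
Open Scope R_scope.

(* A robber evades one cop as soon as some set S of vertices is undominated: for every v in S and
   every other vertex c, some member of S in N[v] lies outside N[c].

   Put a mesh of width 1/m on the square.  If r is at most of order sqrt (ln n / n), take 1/m
   slightly above r; some 3 x 3 window of boxes contains only one point, in its centre, and this
   point is isolated.  Otherwise let k be about sqrt (ln n) and 1/m about r / k^2, so that r is
   about k^2 boxes, and let S be formed by one point in each of the k boxes at the vertices of a
   regular k-gon with sides slightly shorter than r.  A vertex c dominating v in S lies within r
   of both neighbours of v, hence in a lens which, measured in boxes, has length O(k) and width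
   O(1).  Thus S is undominated if the O(k^2) boxes of the k lenses contain no further points.  As
   there are n r^2 / k^4 points per box on average, a given window has this configuration with
   probability n^(-C K3^2 - o(1)), and there are n^(1 - o(1)) disjoint windows.

   In both cases some window succeeds by the second moment method, applied to the assignments of
   the n points to the boxes of the mesh. *)

(** * Windows of boxes and the pattern sought in them *)

Definition block_shift (W j1 j2 : nat) (p : nat * nat) : nat * nat :=
  (j1 * W + fst p, j2 * W + snd p)%nat.

(** In both uses [P] is injective with values in [Q], so each box [P i] of the window holds exactly
    one point and the other boxes of [Q] hold none. Offsets are multiples of the window width [W],
    which keeps different windows disjoint. *)
Definition occupies (n k W : nat) (P : nat -> nat * nat) (Q : list (nat * nat))
    (c : list (nat * nat)) : Prop :=
  exists (j1 j2 : nat) (g : nat -> nat),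
    (forall i, (i < k)%nat -> (g i < n)%nat /\ nth (g i) c (0, 0)%nat = block_shift W j1 j2 (P i)) /\
    (forall u p, (u < n)%nat -> In p Q -> nth u c (0, 0)%nat = block_shift W j1 j2 p ->
       exists i, (i < k)%nat /\ u = g i).

(** * Second moment method, by counting assignments of points to boxes *)

Module Counting.
Import all_boot.
Open Scope nat_scope.
Set Implicit Arguments.
Unset Strict Implicit.
Unset Printing Implicit Defensive.

(** Sum [2ab <= a^2 + b^2] over all pairs of indices in the support. The two moments of a count thus
    bound from below the number of outcomes in which it is positive. *)
Lemma cauchy_schwarz_support (I : finType) (Z : I -> nat) :
  (\sum_i Z i) ^ 2 <= #|[set i | 0 < Z i]| * \sum_i Z i ^ 2.
Proof.
set G := [set i | 0 < Z i].
have supp (F : nat -> nat) : F 0 = 0 -> \sum_i F (Z i) = \sum_(i in G) F (Z i).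
  move=> F0; rewrite [RHS]big_mkcond; apply: eq_bigr => i _.
  by rewrite inE; case: (Z i).
rewrite (supp id) // (supp (fun z => z ^ 2)) //.
rewrite -(leq_pmul2l (isT : 0 < 2)) -mulnn big_distrl /=.
have -> : 2 * (#|G| * \sum_(i in G) Z i ^ 2) =
          \sum_(i in G) \sum_(j in G) (Z i ^ 2 + Z j ^ 2).
  under [RHS]eq_bigr => i _ do rewrite big_split sum_nat_const.
  rewrite big_split /= sum_nat_const -big_distrr /=.
  by rewrite mul2n -addnn.
rewrite big_distrr; apply: leq_sum => i _ /=.
rewrite !big_distrr; apply: leq_sum => j _ /=.
exact: nat_Cauchy.
Qed.

Section SecondMoment.

Variables (T J : finType) (n k q : nat).
Variables (P : J -> 'I_k -> T) (Q : J -> {set T}).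
Hypothesis P_in_Q : forall j i, P j i \in Q j.
Hypothesis P_inj : forall j, injective (P j).
Hypothesis Q_disj : forall j j' t, t \in Q j -> t \in Q j' -> j = j'.
Hypothesis card_Q : forall j, #|Q j| = q.

Notation index := (J * {ffun 'I_k -> 'I_n})%type.

(** The constraint that a placement, that is a window with a choice of points, puts on the point
    [u]: a chosen point has its box prescribed, any other point must avoid the whole of [Q]. As each
    point is constrained separately, the assignments obeying a placement form a [family], whose
    cardinal is a product over the points. *)
Definition slot (x : index) (u : 'I_n) : pred T :=
  if [pick i | x.2 i == u] is Some i then pred1 (P x.1 i) else [predC Q x.1].

Definition placements : {set index} := setX setT [set g : {ffun 'I_k -> 'I_n} | injectiveb g].

Definition successful (f : {ffun 'I_n -> T}) : pred index :=
  [pred x | (x \in placements) && (f \in family (slot x))].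

Lemma placementsE x : (x \in placements) = injectiveb x.2.
Proof. by case: x => j g; rewrite in_setX !inE. Qed.

Lemma card_placements : #|placements| = #|J| * n ^_ k.
Proof.
rewrite cardsX cardsT; congr (_ * _).
rewrite cardsE -[n in RHS]card_ord -[k in RHS]card_ord.
by rewrite -card_inj_ffuns cardsE.
Qed.

Lemma slot_codom x i : x \in placements -> slot x (x.2 i) =1 pred1 (P x.1 i).
Proof.
rewrite placementsE => /injectiveP g_inj t; rewrite /slot.
case: pickP => [i' /eqP /g_inj -> // | /(_ i)]; by rewrite eqxx.
Qed.

Lemma slot_notin (x : index) u : u \notin codom x.2 -> slot x u =1 [predC Q x.1].
Proof.
move=> un t; rewrite /slot; case: pickP => // i /eqP gi.
by rewrite -gi codom_f in un.
Qed.

Lemma card_codom_inj (x : index) : x \in placements -> #|codom x.2| = k.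
Proof. by rewrite placementsE => /injectiveP g_inj; rewrite card_codom // card_ord. Qed.

Lemma prod_const_off (A : pred 'I_n) c :
  \prod_(u | u \notin A) c = c ^ (n - #|A|).
Proof.
rewrite prod_nat_const; congr (_ ^ _).
by have := cardC A; rewrite card_ord => eqn; rewrite -[X in X - _]eqn addKn.
Qed.

(** The [k] chosen points have one box each, the others have [#|T| - q]. *)
Lemma card_family_slot x : x \in placements ->
  #|family (slot x)| = (#|T| - q) ^ (n - k).
Proof.
move=> xP; rewrite card_family foldrE big_map big_enum /=.
rewrite -(card_codom_inj xP) -prod_const_off [RHS]big_mkcond /=.
apply: eq_bigr => u _; case: ifPn => [un | /negbNE /codomP [i ->]].
  rewrite (eq_card (slot_notin un)) -(card_Q x.1) -(cardC (Q x.1)) addKn.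
  exact: eq_card.
by rewrite (eq_card (slot_codom i xP)) card1.
Qed.

Lemma family_slotP x (f : {ffun 'I_n -> T}) :
  reflect (forall u, slot x u (f u)) (f \in family (slot x)).
Proof. by apply: (iffP familyP) => h u; have := h u. Qed.

(** The point that [x] puts into [P j i] lies in [Q j], so [y] must have chosen it as well, and
    injectivity of [P j] gives it the same index. *)
Lemma family_slot_diag x y f : x \in placements -> y \in placements -> x.1 = y.1 ->
  f \in family (slot x) -> f \in family (slot y) -> x = y.
Proof.
move=> xP yP; case: x y xP yP => [j g] [j' g'] xP yP /= jj'; subst j'.
move=> /family_slotP fx /family_slotP fy; congr (_, _); apply/ffunP => i.
have := fx (g i); rewrite (slot_codom i xP) /= => /eqP fgi.
have := fy (g i); have [/codomP [i' gi'] | un] := boolP (g i \in codom g').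
  rewrite gi' (slot_codom i' yP) /= -gi' fgi => /eqP /P_inj ii'.
  by rewrite gi' ii'.
by rewrite (@slot_notin (j, g') _ un) /= fgi P_in_Q.
Qed.

(** Two placements in one window exclude each other, and a point chosen by both would lie in two
    disjoint sets [Q]. In the remaining case the [2 * k] chosen points have at most one box each and
    the others avoid both forbidden sets. *)
Lemma card_family_slot2 x y : x \in placements -> y \in placements -> x != y ->
  #|[pred f | (f \in family (slot x)) && (f \in family (slot y))]|
    <= (#|T| - 2 * q) ^ (n - 2 * k).
Proof.
move=> xP yP xy.
have [e | ne] := eqVneq x.1 y.1.
  rewrite eq_card0 // => f; rewrite !inE; apply/negP => /andP [fx fy].
  by move: xy; rewrite (family_slot_diag xP yP e fx fy) eqxx.
have [/existsP [u /andP [ux uy]] | /existsPn dis] :=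
    boolP [exists u, (u \in codom x.2) && (u \in codom y.2)].
  rewrite eq_card0 // => f; rewrite !inE; apply/negP.
  move=> /andP [/family_slotP /(_ u) fx /family_slotP /(_ u) fy].
  case/codomP: ux => i ui; case/codomP: uy => i' ui'.
  move: fx; rewrite ui (slot_codom i xP) /= -ui => /eqP fx.
  move: fy; rewrite ui' (slot_codom i' yP) /= -ui' => /eqP fy.
  move/eqP: ne; apply; apply: (@Q_disj _ _ (f u)).
    by rewrite fx P_in_Q.
  by rewrite fy P_in_Q.
pose F u : pred T := [predI slot x u & slot y u].
have -> : #|[pred f | (f \in family (slot x)) && (f \in family (slot y))]| = #|family F|.
  apply: eq_card => f; rewrite !inE; apply/andP/familyP.
    by move=> [/familyP fx /familyP fy] u; rewrite inE /=; apply/andP; split; [apply: fx | apply: fy].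
  by move=> fF; split; apply/familyP => u; have := fF u; rewrite inE => /andP [].
rewrite card_family foldrE big_map big_enum /=.
pose A := [predU codom x.2 & codom y.2].
have cA : #|A| = 2 * k.
  have := cardUI (mem (codom x.2)) (mem (codom y.2)).
  rewrite (card_codom_inj xP) (card_codom_inj yP) addnn -mul2n => <-.
  by rewrite [X in _ + X]eq_card0 ?addn0 // => u; have := dis u; rewrite !inE => /negbTE.
rewrite -cA -prod_const_off [X in _ <= X]big_mkcond /=.
apply: leq_prod => u _; rewrite inE /= negb_or.
have [/codomP [i ->] | ux] := boolP (u \in codom x.2) => /=.
  rewrite -(card1 (P x.1 i)) subset_leq_card //; apply/subsetP => t /andP [tx _].
  by rewrite inE -[_ == _]/(pred1 _ _) -(slot_codom i xP).
have [/codomP [i ->] | uy] := boolP (u \in codom y.2) => /=.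
  rewrite -(card1 (P y.1 i)) subset_leq_card //; apply/subsetP => t /andP [_ ty].
  by rewrite inE -[_ == _]/(pred1 _ _) -(slot_codom i yP).
have cQ : #|Q x.1 :|: Q y.1| = 2 * q.
  rewrite cardsU !card_Q addnn -mul2n (_ : _ :&: _ = set0) ?cards0 ?subn0 //.
  apply/setP => t; rewrite !inE; apply/negP => /andP [tx ty].
  by move/eqP: ne; apply; apply: (Q_disj tx ty).
rewrite -cQ -(cardC (mem (Q x.1 :|: Q y.1))) addKn subset_leq_card //.
apply/subsetP => t /andP [tx ty]; rewrite !inE negb_or; apply/andP; split.
  by rewrite -[_ \notin _]/([predC Q x.1] t) -(slot_notin ux).
by rewrite -[_ \notin _]/([predC Q y.1] t) -(slot_notin uy).
Qed.

(* Two placements are compatible only if they lie in different windows and use disjoint sets of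
   points, so their joint probability is that of 2k points avoiding a forbidden set of size 2q. *)
Lemma second_moment (A := #|J| * n ^_ k) (S1 := A * (#|T| - q) ^ (n - k)) :
  S1 ^ 2 <= #|[set f | [exists x, successful f x]]| *
            (S1 + A ^ 2 * (#|T| - 2 * q) ^ (n - 2 * k)).
Proof.
pose Z (f : {ffun 'I_n -> T}) := \sum_(x in placements) (f \in family (slot x) : nat).
have sumZ : \sum_f Z f = S1.
  rewrite exchange_big /= -[S1]/(A * _) /A -card_placements -sum_nat_const.
  apply: eq_bigr => x xP; rewrite -(card_family_slot xP) -sum1_card [RHS]big_mkcond.
  by apply: eq_bigr => f _; case: (_ \in _).
rewrite -sumZ; apply: leq_trans (cauchy_schwarz_support Z) _.
have -> : [set f | 0 < Z f] = [set f | [exists x, successful f x]].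
  apply/setP => f; rewrite !inE lt0n sum_nat_eq0 negb_forall.
  apply/idP/idP => /existsP [x hx]; apply/existsP; exists x; move: hx;
    by rewrite /successful /= negb_imply eqb0 negbK.
rewrite leq_mul2l; apply/orP; right.
have -> : \sum_f Z f ^ 2 = \sum_(x in placements) \sum_(y in placements)
    #|[pred f | (f \in family (slot x)) && (f \in family (slot y))]|.
  under eq_bigr => f _ do rewrite -mulnn big_distrl /=.
  rewrite exchange_big; apply: eq_bigr => x _.
  under eq_bigr => f _ do rewrite big_distrr /=.
  rewrite exchange_big; apply: eq_bigr => y _.
  rewrite -sum1_card [RHS]big_mkcond; apply: eq_bigr => f _.
  rewrite [X in _ = if X then _ else _](_ : _ =
    (f \in family (slot x)) && (f \in family (slot y))) //.
  by case: (f \in family (slot x)); case: (f \in family (slot y)).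
rewrite sumZ -[S1]/(A * _) /A -card_placements -mulnn -mulnA -mulnDr -sum_nat_const.
(* The diagonal term yields the first moment. The off-diagonal terms share one bound, and a diagonal
   term is put back to reach [A ^ 2]. *)
apply: leq_sum => x xP; rewrite (bigD1 x) //=; apply: leq_add.
  by rewrite -(card_family_slot xP) subset_leq_card //; apply/subsetP => f; rewrite inE => /andP [].
rewrite -sum_nat_const [X in _ <= X](bigD1 x) //=.
apply: leq_trans (leq_addl _ _); apply: leq_sum => y /andP [yP yx].
by apply: card_family_slot2; rewrite // eq_sym.
Qed.

End SecondMoment.

(** * Passage from finite types to lists of grid cells *)

Lemma In_mem (T : eqType) (x : T) (s : seq T) : In x s <-> x \in s.
Proof.
elim: s => //= y s IHs; rewrite in_cons; split.
  by move=> [-> | /IHs ->]; rewrite ?eqxx ?orbT.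
by move=> /orP [/eqP -> | /IHs]; [left | right].
Qed.

Lemma NoDup_uniq (T : eqType) (s : seq T) : NoDup s <-> uniq s.
Proof.
elim: s => [|y s IHs] /=; first by split => // _; constructor.
split; first by move=> H; inversion_clear H; apply/andP; split; [apply/negP => /In_mem | apply/IHs].
by move=> /andP [/negP ys /IHs us]; constructor => // /In_mem.
Qed.

Lemma List_nthE (T : Type) (x : T) (s : seq T) i : List.nth i s x = seq.nth x s i.
Proof. by elim: s i => [|y s IHs] [|i] //=. Qed.

Lemma expnE (a b : nat) : a ^ b = Nat.pow a b.
Proof. by elim: b => //= b <-; rewrite expnS. Qed.

Lemma ffact_ge n k : (n - k) ^ k <= n ^_ k.
Proof.
elim: k n => // k IHk n; rewrite ffactnS expnS; apply: leq_mul; first exact: leq_subr.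
by rewrite (_ : n - k.+1 = n.-1 - k) // -subn1 -subnDA add1n.
Qed.

Lemma mulD_inj W a b a' b' : b < W -> b' < W -> a * W + b = a' * W + b' -> a = a' /\ b = b'.
Proof.
move=> bW b'W e; have W0 : 0 < W by apply: leq_ltn_trans bW.
split; last by have := congr1 (modn^~ W) e; rewrite /= !modnMDl !modn_small.
by have := congr1 (divn^~ W) e; rewrite /= !divnMDl // !divn_small // !addn0.
Qed.

(** The window offsets range over a [B] by [B] grid, which fits because [B * W <= m]. [A] is the
    number of placements; it occurs on both sides of the moment inequality and is otherwise known
    only through its lower bound. *)
Lemma many_occupied_cells (n m k W B : nat) (P : nat -> nat * nat) (Q : list (nat * nat)) :
  (0 < m)%coq_nat -> NoDup Q ->
  (forall p, In p Q -> (p.1 < W)%coq_nat /\ (p.2 < W)%coq_nat) ->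
  (forall i, (i < k)%coq_nat -> In (P i) Q) ->
  (forall i i', (i < k)%coq_nat -> (i' < k)%coq_nat -> P i = P i' -> i = i') ->
  (B * W <= m)%coq_nat ->
  exists (L : list (list (nat * nat))) (A : nat),
    [/\ NoDup L,
       Forall (fun c => valid_cell n m c /\ occupies n k W P Q c) L,
       (Nat.pow B 2 * Nat.pow (n - k) k <= A)%coq_nat &
       let S1 := (A * Nat.pow (Nat.pow m 2 - length Q) (n - k))%coq_nat in
       (Nat.pow S1 2 <= length L *
          (S1 + Nat.pow A 2 * Nat.pow (Nat.pow m 2 - 2 * length Q) (n - 2 * k)))%coq_nat].
Proof.
case: m => [/ltP //|m] _ /NoDup_uniq uQ QW PQ Pinj /leP BWm.
pose T := ('I_m.+1 * 'I_m.+1)%type; pose J := ('I_B * 'I_B)%type.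
have QW1 p : p \in Q -> p.1 < W by move=> /In_mem /QW [/ltP].
have QW2 p : p \in Q -> p.2 < W by move=> /In_mem /QW [_ /ltP].
(* [inord] falls back to a default when its argument is out of range; [embE] rules this out for
   boxes of [Q]. *)
pose emb (j : J) (p : nat * nat) : T := (inord (j.1 * W + p.1), inord (j.2 * W + p.2)).
have embE (j : J) p : p \in Q ->
    (val (emb j p).1, val (emb j p).2) = block_shift W j.1 j.2 p.
  move=> pQ; rewrite /block_shift /= !inordK //.
    by apply: leq_trans BWm; apply: leq_trans (_ : j.2.+1 * W <= _);
       rewrite ?leq_mul2r ?ltn_ord ?orbT // mulSn addnC ltn_add2r QW2.
  by apply: leq_trans BWm; apply: leq_trans (_ : j.1.+1 * W <= _);
     rewrite ?leq_mul2r ?ltn_ord ?orbT // mulSn addnC ltn_add2r QW1.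
have emb_inj (j j' : J) p p' : p \in Q -> p' \in Q -> emb j p = emb j' p' -> j = j' /\ p = p'.
  move=> pQ p'Q e; have := embE j p pQ; rewrite e embE // => -[e1 e2].
  have [|| a1 b1] := mulD_inj _ _ (esym e1); rewrite ?QW1 //.
  have [|| a2 b2] := mulD_inj _ _ (esym e2); rewrite ?QW2 //.
  case: j j' a1 a2 {e e1 e2} => [j1 j2] [j1' j2'] /= a1 a2.
  by case: p p' b1 b2 {pQ p'Q} => [? ?] [? ?] /= -> ->; rewrite (val_inj a1) (val_inj a2).
pose Qs j : {set T} := [set t in map (emb j) Q].
pose Ps (j : J) (i : 'I_k) := emb j (P i).
have PQ' (i : 'I_k) : P i \in Q by apply/In_mem/PQ/ltP.
have PsQs j i : Ps j i \in Qs j by rewrite in_set; apply: map_f.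
have Ps_inj j : injective (Ps j).
  move=> i i' /emb_inj [] // _ /Pinj e; apply: val_inj; apply: e; exact/ltP.
have Qs_disj j j' t : t \in Qs j -> t \in Qs j' -> j = j'.
  rewrite !in_set => /mapP [p pQ ->] /mapP [p' p'Q /emb_inj []//].
have card_Qs j : #|Qs j| = size Q.
  rewrite cardsE -(size_map (emb j)); apply/card_uniqP; rewrite map_inj_in_uniq //.
  by move=> p p' pQ p'Q /emb_inj [].
have := second_moment n PsQs Ps_inj Qs_disj card_Qs.
set good := [set f | _]; set A := _ * n ^_ k.
pose cell (f : {ffun 'I_n -> T}) := [seq (val (f u).1, val (f u).2) | u <- enum 'I_n].
have nth_cell f u (un : u < n) : List.nth u (cell f) (0, 0) =
    (val (f (Ordinal un)).1, val (f (Ordinal un)).2).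
  rewrite List_nthE (nth_map (Ordinal un)) ?size_enum_ord //.
  by rewrite (_ : seq.nth _ _ _ = Ordinal un) //; apply: val_inj; rewrite /= nth_enum_ord.
have cell_inj : injective cell.
  move=> f f' ff'; apply/ffunP => u; have := nth_cell f u (ltn_ord u).
  rewrite ff' nth_cell (_ : Ordinal _ = u); last exact: val_inj.
  by case: (f u) (f' u) => [a b] [a' b'] [] /val_inj -> /val_inj ->.
have cell_valid f : valid_cell n m.+1 (cell f).
  split; first by rewrite -[length _]/(size _) size_map size_enum_ord.
  apply/Forall_forall => ab /In_mem /mapP [u _ ->] /=; split; exact/ltP.
have cell_occupies f : f \in good -> occupies n k W P Q (cell f).
  rewrite inE => /existsP [[j g] /= /andP [xP /family_slotP fx]].
  (* The value 0 is a filler for [i >= k], where [occupies] imposes nothing. *)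
  exists (val j.1), (val j.2), (fun i => if insub i is Some i' then val (g i') else 0).
  split.
    move=> i /ltP ik; rewrite insubT /=; split; first exact/ltP.
    rewrite nth_cell -embE ?(PQ' (Ordinal ik)) // (_ : Ordinal _ = g (Ordinal ik)); last exact: val_inj.
    have := fx (g (Ordinal ik)); rewrite (@slot_codom _ _ _ _ Ps Qs (j, g) (Ordinal ik) xP) /= => /eqP ->.
    by [].
  move=> u p /ltP un /In_mem pQ; rewrite nth_cell -embE // => -[e1 e2].
  have {e1 e2} fu : f (Ordinal un) = emb j p.
    by rewrite [LHS]surjective_pairing; congr (_, _); apply: val_inj.
  have := fx (Ordinal un); have [/codomP [i ui] _ | un'] := boolP (Ordinal un \in codom g).
    by exists (val i); split; [apply/ltP; apply: ltn_ord | rewrite valK -ui].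
  by rewrite (@slot_notin _ _ _ _ Ps Qs (j, g) _ un') /= fu in_set; move/negP; case; apply: map_f.
move=> moment; exists [seq cell f | f <- enum good], A; split.
- by apply/NoDup_uniq; rewrite map_inj_uniq // enum_uniq.
- apply/Forall_forall => c /In_mem /mapP [f]; rewrite mem_enum => fgood ->; split=> //.
  exact: cell_occupies.
- by apply/leP; rewrite -!expnE /A card_prod !card_ord leq_mul2l ffact_ge orbT.
rewrite -![Nat.pow _ _]expnE; apply/leP; move: moment; rewrite card_prod !card_ord mulnn.
by rewrite -expnE -[length (map _ _)]/(size _) size_map -cardE.
Qed.
End Counting.

(** * From counts to probabilities *)

Lemma bernoulli_ineq (x : R) (n : nat) : 0 <= x <= 1 -> 1 - INR n * x <= (1 - x) ^ n.
Proof.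
  intros Hx; induction n as [|n IH]; [simpl; lra|].
  rewrite S_INR; simpl pow.
  assert (0 <= INR n) by apply pos_INR.
  apply Rle_trans with ((1 - x) * (1 - INR n * x)); [nra|].
  apply Rmult_le_compat_l; lra.
Qed.

(** Here [X] is the probability of success, [mu] the mean of the count and [mu + Y] a bound for its
    second moment. The hypotheses give [X >= (1 - d) / (1 + 1 / mu)], which exceeds
    [1 - d - 1 / mu]. *)
Lemma second_moment_ratio (X mu Y d mu0 : R) :
  0 <= X -> 0 < mu0 <= mu -> 0 <= d -> 0 <= Y ->
  mu ^ 2 <= X * (mu + Y) -> Y * (1 - d) <= mu ^ 2 -> 1 - d - 1 / mu0 <= X.
Proof.
  intros HX [Hm0 Hm] Hd HY HXY Hvar.
  assert (Hinv : / mu <= / mu0) by (apply Rinv_le_contravar; lra).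
  assert (Hpos : 0 < / mu) by (apply Rinv_0_lt_compat; lra).
  apply Rle_trans with (1 - d - / mu); [unfold Rdiv; lra|].
  (* Multiplying by [1 - d] needs a positive sign; otherwise the claimed bound is negative and
     [0 <= X] suffices. *)
  destruct (Rle_dec (1 - d) 0) as [Hle|Hgt]; [lra|].
  assert (H1 : mu ^ 2 * (1 - d) <= X * (mu + mu ^ 2)).
  { apply Rle_trans with (X * (mu + Y) * (1 - d)).
    - apply Rmult_le_compat_r; lra.
    - rewrite Rmult_assoc; apply Rmult_le_compat_l; [lra|]; nra. }
  assert (H2 : mu * (1 - d) <= X * (1 + mu)).
  { apply Rmult_le_reg_l with mu; [lra|]; nra. }
  apply Rmult_le_reg_r with (mu * (1 + mu)); [nra|].
  replace ((1 - d - / mu) * (mu * (1 + mu))) with ((mu * (1 - d) - 1) * (1 + mu)) by (field; lra).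
  apply Rle_trans with (mu * (mu * (1 - d))); [|nra].
  nra.
Qed.

(** [q] is the chance that a given point falls into the set [Q] of a given window, and [mu] a lower
    bound for the expected number of successful placements. Dividing the counts by [(m^2)^n] reduces
    the claim to [second_moment_ratio] with [d = 2 k q]. *)
Lemma occupied_probability (n m k W B : nat) (P : nat -> nat * nat) (Q : list (nat * nat))
    (E : (nat -> R * R) -> Prop)
    (q := INR (length Q) / INR m ^ 2)
    (mu := INR B ^ 2 * INR (n - k) ^ k * (1 - q) ^ n / (INR m ^ 2) ^ k) :
  (0 < m)%nat -> NoDup Q ->
  (forall p, In p Q -> (fst p < W)%nat /\ (snd p < W)%nat) ->
  (forall i, (i < k)%nat -> In (P i) Q) ->
  (forall i i', (i < k)%nat -> (i' < k)%nat -> P i = P i' -> i = i') ->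
  (B * W <= m)%nat -> (2 * k <= n)%nat -> q <= / 2 -> 0 < mu ->
  (forall c x, valid_cell n m c -> occupies n k W P Q c -> in_cell n m c x -> E x) ->
  prob_ge n E (1 - 2 * INR k * q - 1 / mu).
Proof.
  intros Hm HQ HQW HPQ HP HBW Hk Hq Hmu HE.
  destruct (@Counting.many_occupied_cells n m k W B P Q Hm HQ HQW HPQ HP HBW)
    as (L & A & [HL HLF HA Hmom]).
  exists m, L; repeat split; [exact Hm | exact HL | | ].
  { eapply Forall_impl; [|exact HLF]. intros c [Hv Ho]; split; [exact Hv|].
    intros x Hx; exact (HE c x Hv Ho Hx). }
  apply Rle_ge.
  set (T := INR m ^ 2) in *.
  assert (Hm' : 0 < INR m) by (apply lt_0_INR; exact Hm).
  assert (HT : 0 < T) by (apply pow_lt; exact Hm').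
  assert (HqT : INR (length Q) = q * T) by (unfold q; field; lra).
  assert (Hq0 : 0 <= q).
  { unfold q; apply Rle_mult_inv_pos; [apply pos_INR | exact HT]. }
  assert (Hle : (2 * length Q <= m ^ 2)%nat).
  { apply INR_le; rewrite mult_INR, pow_INR, HqT; fold T; simpl (INR 2); nra. }
  cbv zeta in Hmom.
  apply le_INR in Hmom, HA.
  change (INR ((Nat.pow (A * Nat.pow (Nat.pow m 2 - length Q) (n - k)) 2)) <=
     INR (length L * (A * Nat.pow (Nat.pow m 2 - length Q) (n - k) +
      Nat.pow A 2 * Nat.pow (Nat.pow m 2 - 2 * length Q) (n - 2 * k)))) in Hmom.
  change (INR (Nat.pow B 2 * Nat.pow (n - k) k) <= INR A) in HA.
  rewrite mult_INR, !pow_INR in HA.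
  rewrite pow_INR, !mult_INR, plus_INR, !mult_INR, !pow_INR, !minus_INR, !mult_INR, !pow_INR in Hmom
    by lia.
  fold T in Hmom; rewrite HqT in Hmom.
  replace (INR m ^ (2 * n)) with (T ^ n) by (unfold T; rewrite pow_mult; reflexivity).
  set (a := INR A) in *; set (g := INR (length L)) in *.
  set (t := 1 - q).
  replace (T - q * T) with (t * T) in Hmom by (unfold t; ring).
  replace (T - INR 2 * (q * T)) with ((1 - 2 * q) * T) in Hmom by (simpl; ring).
  assert (Htp : 0 < t) by (unfold t; lra).
  assert (HTk : 0 < T ^ k) by (apply pow_lt; exact HT).
  assert (HTn : 0 < T ^ n) by (apply pow_lt; exact HT).
  assert (Ha : 0 <= a) by apply pos_INR.
  assert (Hsplit : T ^ n = T ^ (n - k) * T ^ k) by (rewrite <- pow_add; f_equal; lia).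
  assert (Hsplit2 : T ^ n = T ^ (n - 2 * k) * (T ^ k * T ^ k)).
  { rewrite <- !pow_add; f_equal; lia. }
  (* The exact mean. [mu] is smaller: it has the lower bound for [A] and the exponent [n] in place
     of [n - k]. *)
  set (mu' := a * t ^ (n - k) / T ^ k).
  set (Y := a ^ 2 * (1 - 2 * q) ^ (n - 2 * k) / (T ^ k * T ^ k)).
  apply second_moment_ratio with (mu := mu') (Y := Y).
  - apply Rle_mult_inv_pos; [apply pos_INR | exact HTn].
  - split; [exact Hmu|].
    unfold mu, mu', Rdiv; apply Rmult_le_compat_r; [left; apply Rinv_0_lt_compat; exact HTk|].
    apply Rmult_le_compat; [ | apply pow_le; fold t; lra | exact HA | ].
    + apply Rmult_le_pos; apply pow_le; apply pos_INR.
    + fold t; replace n with ((n - k) + k)%nat at 1 by lia.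
      rewrite pow_add, <- (Rmult_1_r (t ^ (n - k))) at 1.
      rewrite Rmult_1_r.
      assert (0 < t ^ (n - k)) by (apply pow_lt; exact Htp).
      assert (t ^ k <= 1) by (rewrite <- (pow1 k); apply pow_incr; unfold t; lra).
      nra.
  - apply Rmult_le_pos; [|exact Hq0]. assert (0 <= INR k) by apply pos_INR; lra.
  - apply Rle_mult_inv_pos; [|nra].
    apply Rmult_le_pos; apply pow_le; [exact Ha | lra].
  - rewrite !Rpow_mult_distr in Hmom.
    assert (HTnk : 0 < T ^ (n - k)) by (apply pow_lt; exact HT).
    apply Rmult_le_reg_r with (T ^ n * T ^ n); [nra|].
    replace (mu' ^ 2 * (T ^ n * T ^ n)) with (a ^ 2 * ((t ^ (n - k)) ^ 2 * (T ^ (n - k)) ^ 2)).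
    2:{ unfold mu'; rewrite Hsplit; field; lra. }
    replace (g / T ^ n * (mu' + Y) * (T ^ n * T ^ n)) with (g * (mu' * T ^ n + Y * T ^ n)) by (field; lra).
    replace (mu' * T ^ n) with (a * (t ^ (n - k) * T ^ (n - k))).
    2:{ unfold mu'; rewrite Hsplit; field; lra. }
    replace (Y * T ^ n) with (a ^ 2 * ((1 - 2 * q) ^ (n - 2 * k) * T ^ (n - 2 * k))).
    2:{ unfold Y; rewrite Hsplit2; field; lra. }
    exact Hmom.
  (* Near independence: [1 - 2q <= (1 - q)^2] handles the unchosen points, and Bernoulli's
     inequality pays for the exponent [2k] by which [2(n - k)] exceeds [2(n - 2k)]. *)
  - assert (Hb : 1 - 2 * INR k * q <= t ^ (2 * k)).
    { replace (2 * INR k) with (INR (2 * k)) by (rewrite mult_INR; simpl; ring).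
      apply bernoulli_ineq; lra. }
    assert (Hq2 : (1 - 2 * q) ^ (n - 2 * k) <= (t ^ 2) ^ (n - 2 * k)).
    { apply pow_incr; unfold t; nra. }
    assert (Hz : 0 <= (1 - 2 * q) ^ (n - 2 * k)) by (apply pow_le; lra).
    assert (H2k : 0 < t ^ (2 * k)) by (apply pow_lt; exact Htp).
    apply Rle_trans with (a ^ 2 * ((1 - 2 * q) ^ (n - 2 * k) * t ^ (2 * k)) / (T ^ k * T ^ k)).
    { unfold Y, Rdiv.
      replace (a ^ 2 * (1 - 2 * q) ^ (n - 2 * k) * / (T ^ k * T ^ k) * (1 - 2 * INR k * q))
        with (a ^ 2 * ((1 - 2 * q) ^ (n - 2 * k) * (1 - 2 * INR k * q)) * / (T ^ k * T ^ k)) by ring.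
      apply Rmult_le_compat_r; [left; apply Rinv_0_lt_compat; nra|].
      apply Rmult_le_compat_l; [nra|]. apply Rmult_le_compat_l; lra. }
    unfold mu'.
    replace ((a * t ^ (n - k) / T ^ k) ^ 2)
      with (a ^ 2 * (t ^ (n - k)) ^ 2 / (T ^ k * T ^ k)) by (field; lra).
    unfold Rdiv; apply Rmult_le_compat_r; [left; apply Rinv_0_lt_compat; nra|].
    apply Rmult_le_compat_l; [nra|].
    apply Rle_trans with ((t ^ 2) ^ (n - 2 * k) * t ^ (2 * k)); [apply Rmult_le_compat_r; lra|].
    right; rewrite <- !pow_mult, <- pow_add; f_equal; lia.
Qed.

(** * Strategies of a robber against a single cop *)

Section Evasion.

Variables (V : nat -> Prop) (adj : nat -> nat -> Prop).

(** A win of the cops is a well-founded derivation, and an invariant that the robber can restore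
    after each move of the cops would have to hold all the way down it. *)
Lemma evading_invariant (Inv : list nat -> nat -> Prop) :
  (forall cs r cs', Inv cs r -> Forall2 (step V adj) cs cs' ->
     ~ In r cs' /\ exists r', step V adj r r' /\ ~ In r' cs' /\ Inv cs' r') ->
  forall cs r, cops_win_from V adj cs r -> ~ Inv cs r.
Proof.
  intros Hinv.
  (* The recursive premise sits inside a disjunction, so the induction on the derivation is written
     as an explicit [fix]. *)
  fix rec 3; intros cs r Hwin HI.
  destruct Hwin as [cs r cs' Hmove Hcap].
  destruct (Hinv cs r cs' HI Hmove) as (Hnot & r' & Hstep & Hnot' & HI').
  destruct Hcap as [Hin|Hnext]; [exact (Hnot Hin)|].
  destruct (Hnext r' Hstep) as [Hin|Hwin']; [exact (Hnot' Hin)|].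
  exact (rec cs' r' Hwin' HI').
Qed.

(** [cop_number_gt1] also excludes a win by zero cops; this is where a vertex is needed, on which
    the robber stands still. *)
Lemma single_cop_loses (Inv : nat -> nat -> Prop) :
  (exists v, V v) ->
  (forall c, V c -> exists r, V r /\ r <> c /\ Inv c r) ->
  (forall c r c', Inv c r -> step V adj c c' ->
     c' <> r /\ exists r', step V adj r r' /\ r' <> c' /\ Inv c' r') ->
  cop_number_gt1 V adj.
Proof.
  intros [v Hv] Hstart Hinv k (cs & Hlen & HV & Hwin).
  destruct cs as [|c [|c2 cs]]; simpl in Hlen.
  - exfalso. destruct (Hwin v Hv) as [[]|Hw].
    refine (evading_invariant (fun cs r => cs = nil /\ V r) _ nil v Hw (conj eq_refl Hv)).
    intros cs r cs' [-> Hr] Hmove; inversion Hmove; subst.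
    split; [intros []|]. exists r; repeat split; auto.
  - exfalso. inversion HV as [|? ? Hc _]; subst.
    destruct (Hstart c Hc) as (r & Hr & Hne & HI).
    destruct (Hwin r Hr) as [[Heq|[]]|Hw]; [congruence|].
    refine (evading_invariant (fun cs r => exists c, cs = c :: nil /\ Inv c r) _ _ r Hw _).
    2:{ exists c; auto. }
    clear - Hinv. intros cs r cs' (c & -> & HI) Hmove.
    inversion Hmove as [|? c' ? cs'' Hstep Hnil]; subst. inversion Hnil; subst.
    destruct (Hinv c r c' HI Hstep) as (Hne & r' & Hr' & Hne' & HI').
    split; [intros [?|[]]; congruence|].
    exists r'; split; [exact Hr'|]. split; [intros [?|[]]; congruence|]. exists c'; auto.
  - lia.
Qed.

(** The robber stays in [S] and, before each move of the cop, outside the cop's closed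
    neighbourhood. Wherever the cop then moves, the hypothesis on [S] offers a step that restores
    this. Having two members in [S] provides a start away from the cop. *)
Lemma undominated_set_evades (S : nat -> Prop) :
  (forall v, S v -> V v) ->
  (exists v v', S v /\ S v' /\ v <> v') ->
  (forall v c, S v -> V c -> c <> v ->
     exists v', S v' /\ step V adj v v' /\ ~ step V adj c v') ->
  cop_number_gt1 V adj.
Proof.
  intros HSV (v1 & v2 & H1 & H2 & H12) Hund.
  apply single_cop_loses with (Inv := fun c r => S r /\ ~ step V adj c r).
  - exists v1; auto.
  - intros c Hc.
    assert (Hex : exists v, S v /\ c <> v).
    { destruct (Nat.eq_dec c v1) as [->|Hne]; [exists v2 | exists v1]; auto. }
    destruct Hex as (v & Hv & Hcv).
    destruct (Hund v c Hv Hc Hcv) as (v' & Hv' & _ & Hn).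
    exists v'; repeat split; auto.
    intros ->; apply Hn; split; auto.
  - intros c r c' [Hr Hn] Hstep.
    assert (Hne : c' <> r) by (intros ->; exact (Hn Hstep)).
    split; [exact Hne|].
    destruct (Hund r c' Hr (proj1 Hstep) Hne) as (v' & Hv' & Hs & Hn').
    exists v'; repeat split; auto; try apply Hs.
    intros ->; apply Hn'; split; auto.
Qed.

(** One of the players sits on the isolated vertex: the robber if the cop starts elsewhere, or else
    the cop, who can then never leave it. *)
Lemma isolated_vertex_evades (v w : nat) :
  V v -> V w -> v <> w -> (forall u, ~ adj u v) -> (forall u, ~ adj v u) ->
  cop_number_gt1 V adj.
Proof.
  intros Hv Hw Hvw Hto Hfrom; apply not_eq_sym in Hvw.
  apply single_cop_loses
    with (Inv := fun c r => V r /\ ((r = v /\ c <> v) \/ (c = v /\ r <> v))).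
  - exists v; exact Hv.
  - intros c Hc; destruct (Nat.eq_dec c v) as [Heq|Hne]; [subst c|].
    + exists w; tauto.
    + exists v; intuition congruence.
  - intros c r c' [Hr [[-> Hc]|[-> Hrv]]] [Hc' [Heq|Hadj]].
    + subst c'; split; [exact Hc|]. exists v; repeat split; auto.
    + assert (c' <> v) by (intros ->; exact (Hto c Hadj)).
      split; [assumption|]. exists v; repeat split; auto.
    + subst c'; split; [auto|]. exists r; repeat split; auto.
    + exfalso; exact (Hfrom c' Hadj).
Qed.

End Evasion.

(** * Elementary estimates for sine, cosine, distances and floors *)

Lemma Rabs_le_inv (a b : R) : Rabs a <= b -> - b <= a <= b.
Proof. unfold Rabs; destruct (Rcase_abs a); lra. Qed.

Lemma cos_ge_quadratic (x : R) : 0 < x -> 1 - x ^ 2 / 2 <= cos x.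
Proof.
  intros Hx; replace x with (2 * (x / 2)) at 2 by field.
  rewrite cos_2a_sin.
  assert (H : sin (x / 2) <= x / 2) by (left; apply sin_lt_x; lra).
  assert (H' : - (x / 2) <= sin (x / 2)).
  { destruct (Rle_dec x PI) as [Hp|Hp].
    - assert (0 <= sin (x / 2)) by (apply sin_ge_0; lra); lra.
    - pose proof (SIN_bound (x / 2)); pose proof PI2_3_2; lra. }
  nra.
Qed.

Lemma sin_ge_half (x : R) : 0 < x <= 1 -> x / 2 <= sin x.
Proof.
  intros [H0 H1].
  destruct (MVT_cor2 sin cos 0 x H0 (fun c _ => derivable_pt_lim_sin c)) as (c & Hc & Hc0 & Hcx).
  rewrite sin_0 in Hc.
  assert (Hcos : 1 - c ^ 2 / 2 <= cos c) by (apply cos_ge_quadratic; exact Hc0).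
  nra.
Qed.

(** Cosine decreases on [[0, PI]], and the reflection of [x] to [2 PI - x] covers the other half. *)
Lemma cos_le_away (t x : R) : 0 <= t -> t <= x <= 2 * PI - t -> cos x <= cos t.
Proof.
  intros Ht Hx.
  destruct (Rle_dec x PI) as [Hp|Hp].
  - apply cos_decr_1; lra.
  - replace (cos x) with (cos (2 * PI - x)).
    2:{ replace (2 * PI - x) with (- x + 2 * INR 1 * PI) by (simpl; ring).
        rewrite cos_period; apply cos_neg. }
    apply cos_decr_1; lra.
Qed.

(** [3 / 2] is a rational bound for [sqrt 2], the diagonal of a unit box. *)
Lemma dist_euc_le_box (a b c d : R) : Rabs (a - c) <= 1 -> Rabs (b - d) <= 1 ->
  dist_euc a b c d <= 3 / 2.
Proof.
  intros H1 H2; apply Rabs_le_inv in H1; apply Rabs_le_inv in H2.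
  unfold dist_euc; rewrite <- (sqrt_square (3 / 2)) by lra.
  apply sqrt_le_1_alt; unfold Rsqr; nra.
Qed.

Lemma dist_euc_le (a b c d r : R) : dist_euc a b c d <= r ->
  (a - c) ^ 2 + (b - d) ^ 2 <= r ^ 2.
Proof.
  unfold dist_euc; intros H.
  assert (Hp : 0 <= Rsqr (a - c) + Rsqr (b - d)).
  { pose proof (Rle_0_sqr (a - c)); pose proof (Rle_0_sqr (b - d)); lra. }
  pose proof (sqrt_pos (Rsqr (a - c) + Rsqr (b - d))) as Hs.
  pose proof (sqrt_sqrt _ Hp) as Hz.
  rewrite !Rsqr_pow2 in Hz, H, Hs; nra.
Qed.

(** Negative reals are sent to 0, so positions must be shown nonnegative before their boxes mean
    anything. *)
Definition nfloor (x : R) : nat := Z.to_nat (Int_part x).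

Lemma nfloor_spec (x : R) : 0 <= x -> INR (nfloor x) <= x < INR (nfloor x) + 1.
Proof.
  intros Hx; unfold nfloor; destruct (base_Int_part x) as [H1 H2].
  assert (Hz : (0 <= Int_part x)%Z).
  { assert (Hlt : (-1 < Int_part x)%Z) by (apply lt_IZR; simpl; lra). lia. }
  rewrite INR_IZR_INZ, Z2Nat.id by exact Hz. lra.
Qed.

(** * The regular polygon and its lenses, in units of one box *)

Section Polygon.

Variable k : nat.
Hypothesis k_large : (100 <= k)%nat.

Definition turn : R := 2 * PI / INR k.
(** The deficit 3 is twice the error [3 / 2] made when a vertex is replaced by a point of its box:
    points in the boxes of consecutive vertices are still within [k^2]. *)
Definition side : R := INR k ^ 2 - 3.
Definition radius : R := side / (2 * sin (PI / INR k)).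
Definition centre : R := INR k ^ 3.

(* [vx i], [vy i] is the vertex in direction [i * turn] of a regular [k]-gon with sides of
   length [side], centred in the window [[0, 2 k^3]^2]. *)
Definition vx (i : nat) : R := centre + radius * cos (INR i * turn).
Definition vy (i : nat) : R := centre + radius * sin (INR i * turn).

Definition polygon_box (i : nat) : nat * nat := (nfloor (vx i), nfloor (vy i)).

Let INR_k_large : 100 <= INR k.
Proof. replace 100 with (INR 100) by (simpl; lra). apply le_INR; exact k_large. Qed.

Lemma half_turn_bounds : 3 / INR k < PI / INR k <= 4 / INR k /\ 4 / INR k <= 1 / 25.
Proof.
  pose proof PI2_3_2; pose proof PI_4.
  assert (0 < / INR k) by (apply Rinv_0_lt_compat; lra).
  repeat split; [unfold Rdiv; nra | unfold Rdiv; nra |].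
  apply Rmult_le_reg_r with (INR k); [lra|]. unfold Rdiv at 1; rewrite Rmult_assoc, Rinv_l; lra.
Qed.

Lemma sin_half_turn_bounds : 3 / (2 * INR k) <= sin (PI / INR k) <= 4 / INR k.
Proof.
  destruct half_turn_bounds as [[H1 H2] H3].
  assert (H0 : 0 < 3 / INR k) by (apply Rdiv_lt_0_compat; lra).
  split.
  - replace (3 / (2 * INR k)) with (3 / INR k / 2) by (field; lra).
    pose proof (sin_ge_half (PI / INR k)). lra.
  - pose proof (sin_lt_x (PI / INR k)). lra.
Qed.

Lemma radius_bounds : 0 < radius <= INR k ^ 3 / 3.
Proof.
  destruct sin_half_turn_bounds as [H1 H2].
  assert (H0 : 0 < 3 / (2 * INR k)) by (apply Rdiv_lt_0_compat; lra).
  assert (Hs : 0 < side) by (unfold side; nra).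
  unfold radius; split; [apply Rdiv_lt_0_compat; lra|].
  apply Rmult_le_reg_r with (2 * sin (PI / INR k)); [lra|].
  replace (side / (2 * sin (PI / INR k)) * (2 * sin (PI / INR k))) with side by (field; lra).
  apply Rle_trans with (INR k ^ 3 / 3 * (2 * (3 / (2 * INR k)))).
  - replace (INR k ^ 3 / 3 * (2 * (3 / (2 * INR k)))) with (INR k ^ 2) by (field; lra).
    unfold side; lra.
  - apply Rmult_le_compat_l; [|lra]. assert (0 < INR k ^ 3) by (apply pow_lt; lra). lra.
Qed.

Lemma radius_side : 2 * radius * sin (PI / INR k) = side.
Proof.
  destruct sin_half_turn_bounds as [H1 H2].
  assert (H0 : 0 < 3 / (2 * INR k)) by (apply Rdiv_lt_0_compat; lra).
  unfold radius; field; lra.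
Qed.

Lemma turn_half : turn = 2 * (PI / INR k).
Proof. unfold turn; field; lra. Qed.

(** Half the distance between the two neighbours of a vertex, equal to [side * cos (PI / k)]. The
    loss 11 is 3 from [side] and at most 8 from the cosine. *)
Lemma radius_sin_turn : radius * sin turn >= INR k ^ 2 - 11.
Proof.
  rewrite turn_half, sin_2a.
  replace (radius * (2 * sin (PI / INR k) * cos (PI / INR k)))
    with (2 * radius * sin (PI / INR k) * cos (PI / INR k)) by ring.
  rewrite radius_side.
  destruct half_turn_bounds as [[H1 H2] H3].
  assert (H0 : 0 < 3 / INR k) by (apply Rdiv_lt_0_compat; lra).
  pose proof (cos_ge_quadratic (PI / INR k) ltac:(lra)) as Hc.
  assert (Hs : 0 < side) by (unfold side; nra).
  assert (Hq : (PI / INR k) ^ 2 / 2 <= 8 / INR k ^ 2).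
  { replace (8 / INR k ^ 2) with ((4 / INR k) ^ 2 / 2) by (field; lra).
    assert ((PI / INR k) ^ 2 <= (4 / INR k) ^ 2) by (apply pow_incr; lra). lra. }
  apply Rle_ge, Rle_trans with (side * (1 - 8 / INR k ^ 2)); [|nra].
  assert (Hinv : side * (8 / INR k ^ 2) <= 8).
  { apply Rle_trans with (INR k ^ 2 * (8 / INR k ^ 2)).
    - apply Rmult_le_compat_r; [|unfold side; lra].
      apply Rle_mult_inv_pos; [lra|apply pow_lt; lra].
    - right; field; lra. }
  unfold side in *; lra.
Qed.

(** How far the neighbours of a vertex lie behind it in the radial direction: this is
    [side * sin (PI / k)], at most [k^2 * (4 / k)]. *)
Lemma radius_cos_turn : 0 <= radius * (1 - cos turn) <= 4 * INR k.
Proof.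
  rewrite turn_half, cos_2a_sin.
  replace (radius * (1 - (1 - 2 * sin (PI / INR k) * sin (PI / INR k))))
    with (2 * radius * sin (PI / INR k) * sin (PI / INR k)) by ring.
  rewrite radius_side.
  destruct sin_half_turn_bounds as [H1 H2].
  assert (H0 : 0 < 3 / (2 * INR k)) by (apply Rdiv_lt_0_compat; lra).
  assert (Hs : 0 < side <= INR k ^ 2) by (unfold side; nra).
  split; [nra|].
  apply Rle_trans with (INR k ^ 2 * (4 / INR k)); [|right; field; lra].
  apply Rmult_le_compat; lra.
Qed.

Lemma vertex_range (i : nat) :
  centre - radius <= vx i <= centre + radius /\ centre - radius <= vy i <= centre + radius.
Proof.
  pose proof radius_bounds; pose proof (COS_bound (INR i * turn)); pose proof (SIN_bound (INR i * turn)).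
  unfold vx, vy; repeat split; nra.
Qed.

Lemma vertex_dist2 (i j : nat) :
  (vx i - vx j) ^ 2 + (vy i - vy j) ^ 2 = 2 * radius ^ 2 * (1 - cos (INR i * turn - INR j * turn)).
Proof.
  unfold vx, vy; rewrite cos_minus.
  pose proof (sin2_cos2 (INR i * turn)) as Hi; pose proof (sin2_cos2 (INR j * turn)) as Hj.
  unfold Rsqr in *.
  set (ci := cos (INR i * turn)) in *; set (si := sin (INR i * turn)) in *.
  set (cj := cos (INR j * turn)) in *; set (sj := sin (INR j * turn)) in *.
  replace ((centre + radius * ci - (centre + radius * cj)) ^ 2 +
           (centre + radius * si - (centre + radius * sj)) ^ 2)
    with (radius ^ 2 * ((si * si + ci * ci) + (sj * sj + cj * cj) - 2 * (ci * cj + si * sj))) by ring.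
  rewrite Hi, Hj; ring.
Qed.

Lemma side_sq : 2 * radius ^ 2 * (1 - cos turn) = side ^ 2.
Proof. rewrite <- radius_side, turn_half, cos_2a_sin; ring. Qed.

(** The indices differ by 1 to [k - 1], so the angle between the vertices lies in
    [[turn, 2 PI - turn]] and the chord is no shorter than a side. *)
Lemma vertices_far (i j : nat) : (i < k)%nat -> (j < k)%nat -> i <> j ->
  side ^ 2 <= (vx i - vx j) ^ 2 + (vy i - vy j) ^ 2.
Proof.
  assert (Hwlog : forall i j, (i < k)%nat -> (j < i)%nat ->
            side ^ 2 <= (vx i - vx j) ^ 2 + (vy i - vy j) ^ 2).
  { clear i j; intros i j Hi Hj.
    rewrite vertex_dist2, <- side_sq.
    apply Rmult_le_compat_l; [nra|].
    assert (Hcos : cos (INR i * turn - INR j * turn) <= cos turn); [|lra].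
    destruct half_turn_bounds as [[H1 H2] H3].
    assert (H0 : 0 < 3 / INR k) by (apply Rdiv_lt_0_compat; lra).
    assert (Ht : 0 < turn) by (rewrite turn_half; lra).
    replace (INR i * turn - INR j * turn) with (INR (i - j) * turn)
      by (rewrite minus_INR by lia; ring).
    apply cos_le_away; [lra|].
    assert (Hlo : 1 <= INR (i - j)) by (apply (le_INR 1); lia).
    assert (Hhi : INR (i - j) <= INR k - 1).
    { change 1 with (INR 1); rewrite <- minus_INR by lia. apply le_INR; lia. }
    replace (2 * PI - turn) with ((INR k - 1) * turn) by (unfold turn; field; lra).
    nra. }
  intros Hi Hj Hne.
  destruct (Nat.lt_total i j) as [Hlt|[Heq|Hlt]]; [|lia|auto].
  rewrite Rplus_comm.
  replace ((vy i - vy j) ^ 2 + (vx i - vx j) ^ 2)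
    with ((vx j - vx i) ^ 2 + (vy j - vy i) ^ 2) by ring.
  auto.
Qed.

(** Describing the neighbour by the sine and cosine of its angle hides the wrap-around from [k - 1]
    to 0 behind periodicity. *)
Lemma next_vertex (i : nat) : (i < k)%nat -> exists i', (i' < k)%nat /\
  cos (INR i' * turn) = cos (INR i * turn + turn) /\
  sin (INR i' * turn) = sin (INR i * turn + turn).
Proof.
  intros Hi; destruct (Nat.eq_dec (S i) k) as [He|He].
  - exists 0%nat; split; [lia|].
    replace (INR i * turn + turn) with (INR 0 * turn + 2 * INR 1 * PI).
    2:{ replace (INR i * turn + turn) with (INR (S i) * turn) by (rewrite S_INR; ring).
        rewrite He; unfold turn; simpl (INR 0); simpl (INR 1); field; lra. }
    rewrite cos_period, sin_period; auto.
  - exists (S i); split; [lia|].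
    rewrite S_INR; replace ((INR i + 1) * turn) with (INR i * turn + turn) by ring; auto.
Qed.

Lemma prev_vertex (i : nat) : (i < k)%nat -> exists i', (i' < k)%nat /\
  cos (INR i' * turn) = cos (INR i * turn - turn) /\
  sin (INR i' * turn) = sin (INR i * turn - turn).
Proof.
  intros Hi; destruct i as [|i].
  - exists (k - 1)%nat; split; [lia|].
    rewrite minus_INR by lia.
    replace ((INR k - INR 1) * turn) with (INR 0 * turn - turn + 2 * INR 1 * PI).
    2:{ unfold turn; simpl (INR 0); simpl (INR 1); field; lra. }
    rewrite cos_period, sin_period; auto.
  - exists i; split; [lia|].
    rewrite S_INR; replace ((INR i + 1) * turn - turn) with (INR i * turn) by ring; auto.
Qed.

Lemma adjacent_vertices (i i' : nat) (e : R) : e = turn \/ e = - turn ->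
  cos (INR i' * turn) = cos (INR i * turn + e) -> sin (INR i' * turn) = sin (INR i * turn + e) ->
  dist_euc (vx i) (vy i) (vx i') (vy i') = side.
Proof.
  intros He Hc Hs; unfold dist_euc; rewrite !Rsqr_pow2, vertex_dist2.
  assert (Hs0 : 0 <= side) by (unfold side; nra).
  rewrite cos_minus, Hc, Hs, <- cos_minus.
  replace (INR i * turn - (INR i * turn + e)) with (- e) by ring.
  rewrite cos_neg.
  replace (cos e) with (cos turn) by (destruct He as [-> | ->]; [|rewrite cos_neg]; reflexivity).
  rewrite side_sq; apply sqrt_pow2; exact Hs0.
Qed.

(** Rotation by [- phi] is an isometry. In the radial coordinate [p] and the tangential coordinate
    [b], the neighbours at [e = turn] and [e = - turn] become mirror images. *)
Lemma dist2_rotated (x y phi e : R)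
    (p := x * cos phi + y * sin phi) (b := - x * sin phi + y * cos phi) :
  (x - radius * cos (phi + e)) ^ 2 + (y - radius * sin (phi + e)) ^ 2 =
  (p - radius * cos e) ^ 2 + (b - radius * sin e) ^ 2.
Proof.
  unfold p, b; rewrite cos_plus, sin_plus.
  pose proof (sin2_cos2 phi) as H; unfold Rsqr in H.
  set (c := cos phi) in *; set (s := sin phi) in *.
  set (ce := cos e); set (se := sin e).
  transitivity (x ^ 2 + y ^ 2 - 2 * radius * (x * (c * ce - s * se) + y * (s * ce + c * se))
          + radius ^ 2 * (ce ^ 2 + se ^ 2) * (s * s + c * c)); [ring|].
  transitivity ((x ^ 2 + y ^ 2) * (s * s + c * c)
          - 2 * radius * (x * (c * ce - s * se) + y * (s * ce + c * se))
          + radius ^ 2 * (ce ^ 2 + se ^ 2)); [rewrite H|]; ring.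
Qed.

(* The discs around the two neighbours of a vertex meet in a lens of bounded width whose
   length, in the radial direction, is only of order [k]. *)
Lemma lens_bounds (i i1 i2 : nat) (x y rho : R)
    (phi := INR i * turn)
    (a := (x - vx i) * cos phi + (y - vy i) * sin phi)
    (b := - (x - vx i) * sin phi + (y - vy i) * cos phi) :
  cos (INR i1 * turn) = cos (phi + turn) -> sin (INR i1 * turn) = sin (phi + turn) ->
  cos (INR i2 * turn) = cos (phi - turn) -> sin (INR i2 * turn) = sin (phi - turn) ->
  0 <= rho <= INR k ^ 2 + 5 / 2 ->
  dist_euc x y (vx i1) (vy i1) <= rho -> dist_euc x y (vx i2) (vy i2) <= rho ->
  Rabs a <= 10 * INR k /\ Rabs b <= 14.
Proof.
  intros Hc1 Hs1 Hc2 Hs2 Hrho H1 H2.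
  apply dist_euc_le in H1; apply dist_euc_le in H2.
  unfold vx at 1, vy at 1 in H1; unfold vx at 1, vy at 1 in H2.
  rewrite Hc1, Hs1 in H1; rewrite Hc2, Hs2 in H2.
  set (X := x - centre); set (Y := y - centre).
  set (p := X * cos phi + Y * sin phi).
  assert (Hb : b = - X * sin phi + Y * cos phi) by (unfold b, vx, vy, X, Y; fold phi; ring).
  assert (Ha : a = p - radius).
  { unfold a, p, vx, vy, X, Y; fold phi.
    pose proof (sin2_cos2 phi) as H; unfold Rsqr in H.
    transitivity ((x - centre) * cos phi + (y - centre) * sin phi -
      radius * (sin phi * sin phi + cos phi * cos phi)); [ring | rewrite H; ring]. }
  replace (x - (centre + radius * cos (phi + turn))) with (X - radius * cos (phi + turn)) in H1
    by (unfold X; ring).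
  replace (y - (centre + radius * sin (phi + turn))) with (Y - radius * sin (phi + turn)) in H1
    by (unfold Y; ring).
  replace (x - (centre + radius * cos (phi - turn))) with (X - radius * cos (phi + - turn)) in H2
    by (unfold X, Rminus; ring).
  replace (y - (centre + radius * sin (phi - turn))) with (Y - radius * sin (phi + - turn)) in H2
    by (unfold Y, Rminus; ring).
  rewrite dist2_rotated in H1; rewrite dist2_rotated, cos_neg, sin_neg in H2.
  fold p in H1; fold p in H2; rewrite <- Hb in H1; rewrite <- Hb in H2.
  pose proof radius_sin_turn as Hs; pose proof radius_cos_turn as Hcos.
  set (s := radius * sin turn) in *.
  replace (b - radius * - sin turn) with (b + s) in H2 by (unfold s; ring).
  assert (Hq : p - radius * cos turn = a + radius * (1 - cos turn)) by (rewrite Ha; ring).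
  rewrite Hq in H1; rewrite Hq in H2.
  set (h := radius * (1 - cos turn)) in *.
  assert (Hk2 : 100 * INR k <= INR k ^ 2) by nra.
  (* Of the two disc inequalities, with [b - s] and [b + s], the one with the larger square is
     kept. *)
  assert (Habs : (a + h) ^ 2 + (Rabs b + s) ^ 2 <= rho ^ 2).
  { unfold Rabs; destruct (Rcase_abs b); nra. }
  assert (Hb0 : 0 <= Rabs b) by apply Rabs_pos.
  split.
  (* [(k^2 + 5/2)^2 - (k^2 - 11)^2] is below [27 k^2], hence below [(6 k)^2]; the shift [h <= 4 k]
     then gives [10 k]. *)
  - assert (Hw : (a + h) ^ 2 <= (6 * INR k) ^ 2).
    { apply Rle_trans with (rho ^ 2 - s ^ 2); [nra|].
      assert (Hrs : rho ^ 2 <= (INR k ^ 2 + 5 / 2) ^ 2) by (apply pow_incr; lra).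
      assert (Hss : (INR k ^ 2 - 11) ^ 2 <= s ^ 2) by (apply pow_incr; nra).
      nra. }
    assert (Hah : Rabs (a + h) <= 6 * INR k).
    { rewrite <- (Rabs_right (6 * INR k)) by lra. apply Rsqr_le_abs_0.
      rewrite !Rsqr_pow2; exact Hw. }
    apply Rabs_le_inv in Hah; apply Rabs_le; lra.
  (* The bound 14 rounds up [5/2 + 11]. *)
  - assert (Hbs : Rabs b + s <= rho); [|lra].
    assert (0 <= Rabs b + s) by lra.
    pose proof (pow2_ge_0 (a + h)).
    apply Rsqr_incr_0; [rewrite !Rsqr_pow2|..]; lra.
Qed.

End Polygon.

(** * Boxes covering the lenses *)

Definition pair_eq_dec (p q : nat * nat) : {p = q} + {p <> q}.
Proof. decide equality; apply Nat.eq_dec. Defined.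

Lemma mult_unit_bounds (u c U : R) : - U <= u <= U -> -1 <= c <= 1 -> - U <= u * c <= U.
Proof. intros Hu Hc; nra. Qed.

Section Lens.

Variable k : nat.
Definition lens_x (i j l : nat) : R :=
  vx k i + (INR j - 10 * INR k) * cos (INR i * turn k) - (INR l - 14) * sin (INR i * turn k).
Definition lens_y (i j l : nat) : R :=
  vy k i + (INR j - 10 * INR k) * sin (INR i * turn k) + (INR l - 14) * cos (INR i * turn k).

(* [j] and [l] run over a unit net of the lens at vertex [i], given by its radial and
   tangential coordinates shifted by [10 k] and [14]; [d] and [e], shifted by [3], run over
   the boxes around a point of the net. *)
Definition lens_box (i j l d e : nat) : nat * nat :=
  (nfloor (lens_x i j l) + d - 3, nfloor (lens_y i j l) + e - 3)%nat.

Definition lens_indices : list (nat * (nat * (nat * (nat * nat)))) :=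
  list_prod (seq 0 k) (list_prod (seq 0 (20 * k + 1))
    (list_prod (seq 0 29) (list_prod (seq 0 7) (seq 0 7)))).

Definition lens_boxes : list (nat * nat) :=
  nodup pair_eq_dec
    (map (fun '(i, (j, (l, (d, e)))) => lens_box i j l d e) lens_indices).

(** The vertex [i] is kept apart because the cop, once located in a lens, has to be identified with
    the chosen point of that very vertex. *)
Definition lens_at (i : nat) (p : nat * nat) : Prop :=
  exists j l d e, (j <= 20 * k)%nat /\ (l <= 28)%nat /\ (d <= 6)%nat /\ (e <= 6)%nat /\
    p = lens_box i j l d e.

Lemma in_lens_boxes (p : nat * nat) :
  In p lens_boxes <-> exists i, (i < k)%nat /\ lens_at i p.
Proof.
  unfold lens_boxes, lens_indices; rewrite nodup_In, in_map_iff; split.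
  - intros ([i [j [l [d e]]]] & Heq & Hin).
    rewrite !in_prod_iff, !in_seq in Hin.
    exists i; split; [lia|]. exists j, l, d, e; repeat split; try lia; congruence.
  - intros (i & Hi & j & l & d & e & Hj & Hl & Hd & He & ->).
    exists (i, (j, (l, (d, e)))); split; [reflexivity|].
    rewrite !in_prod_iff, !in_seq; lia.
Qed.

Hypothesis k_large : (100 <= k)%nat.

Let INR_k_large : 100 <= INR k.
Proof. replace 100 with (INR 100) by (simpl; lra). apply le_INR; exact k_large. Qed.

(** Each of the [k] lenses has [(20 k + 1) * 29] net points with 49 boxes each, in total
    [28420 k^2 + 1421 k] before duplicates are removed. *)
Lemma length_lens_boxes : INR (length lens_boxes) <= 30000 * INR k ^ 2.
Proof.
  apply Rle_trans with (INR (k * ((20 * k + 1) * (29 * (7 * 7))))).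
  - apply le_INR; unfold lens_boxes.
    eapply Nat.le_trans; [apply NoDup_incl_length; [apply NoDup_nodup|]|].
    + intros p Hp; apply nodup_In in Hp; exact Hp.
    + unfold lens_indices; rewrite length_map, !length_prod, !length_seq; lia.
  - rewrite !mult_INR, plus_INR, mult_INR. simpl (INR 20); simpl (INR 1); simpl (INR 29); simpl (INR 7).
    nra.
Qed.

Lemma cube_large : 10000 * INR k <= INR k ^ 3.
Proof. nra. Qed.

(** A crude bound of order [k], enough to separate a lens from the other vertices, which are about
    [k^2] away, and to keep it inside the window. *)
Lemma lens_at_near (i : nat) (p : nat * nat) : lens_at i p ->
  Rabs (INR (fst p) - vx k i) <= 10 * INR k + 20 /\ Rabs (INR (snd p) - vy k i) <= 10 * INR k + 20.
Proof.
  intros (j & l & d & e & Hj & Hl & Hd & He & ->).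
  apply le_INR in Hj, Hl; rewrite mult_INR in Hj; simpl (INR 20) in Hj; simpl (INR 28) in Hl.
  pose proof (pos_INR j) as Hj0; pose proof (pos_INR l) as Hl0.
  pose proof (COS_bound (INR i * turn k)) as Hc; pose proof (SIN_bound (INR i * turn k)) as Hs.
  pose proof cube_large as H3; pose proof (radius_bounds k k_large) as HR.
  pose proof (vertex_range k k_large i) as HV.
  unfold centre in HV.
  assert (Hbox : forall z v d, (d <= 6)%nat -> Rabs (z - v) <= 10 * INR k + 14 ->
            INR k ^ 3 - radius k <= v ->
            Rabs (INR (nfloor z + d - 3) - v) <= 10 * INR k + 20).
  { clear d e Hd He; intros z v d Hd Hz Hv; apply Rabs_le_inv in Hz.
    assert (Hf : INR (nfloor z) <= z < INR (nfloor z) + 1) by (apply nfloor_spec; lra).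
    (* The lens stays away from the lower and left edges of the window, so the [- 3] in [lens_box]
       is not truncated. *)
    assert (H3f : (3 <= nfloor z)%nat).
    { apply INR_le; simpl (INR 3); lra. }
    rewrite minus_INR, plus_INR by lia; simpl (INR 3).
    apply le_INR in Hd; simpl (INR 6) in Hd; pose proof (pos_INR d).
    apply Rabs_le; lra. }
  set (cc := cos (INR i * turn k)) in *; set (ss := sin (INR i * turn k)) in *.
  split; apply Hbox; try assumption; try lra.
  - unfold lens_x; fold cc; fold ss; apply Rabs_le.
    pose proof (mult_unit_bounds (INR j - 10 * INR k) cc (10 * INR k)).
    pose proof (mult_unit_bounds (INR l - 14) ss 14); lra.
  - unfold lens_y; fold cc; fold ss; apply Rabs_le.
    pose proof (mult_unit_bounds (INR j - 10 * INR k) ss (10 * INR k)).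
    pose proof (mult_unit_bounds (INR l - 14) cc 14); lra.
Qed.

Lemma polygon_box_spec (i : nat) :
  INR (fst (polygon_box k i)) <= vx k i < INR (fst (polygon_box k i)) + 1 /\
  INR (snd (polygon_box k i)) <= vy k i < INR (snd (polygon_box k i)) + 1.
Proof.
  pose proof (vertex_range k k_large i) as HV; pose proof (radius_bounds k k_large) as HR.
  pose proof cube_large as H3; unfold centre in HV.
  unfold polygon_box; simpl fst; simpl snd; split; apply nfloor_spec; lra.
Qed.

(** Separation of scales: the lens reaches [O(k)] from its vertex, while any other vertex is at
    least [k^2 - 3] away. *)
Lemma polygon_box_lens_at (i i' : nat) : (i < k)%nat -> (i' < k)%nat ->
  lens_at i (polygon_box k i') -> i' = i.
Proof.
  intros Hi Hi' Hl; destruct (Nat.eq_dec i' i) as [|Hne]; [assumption|exfalso].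
  destruct (lens_at_near _ _ Hl) as [H1 H2]; apply Rabs_le_inv in H1; apply Rabs_le_inv in H2.
  destruct (polygon_box_spec i') as [H3 H4].
  pose proof (vertices_far k k_large i' i Hi' Hi Hne) as Hfar.
  assert (Hx : Rsqr (vx k i' - vx k i) <= Rsqr (10 * INR k + 21)) by (apply neg_pos_Rsqr_le; lra).
  assert (Hy : Rsqr (vy k i' - vy k i) <= Rsqr (10 * INR k + 21)) by (apply neg_pos_Rsqr_le; lra).
  rewrite !Rsqr_pow2 in Hx, Hy.
  unfold side in Hfar.
  assert (Hbig : 20 * INR k + 50 <= INR k ^ 2 - 3) by nra.
  assert ((20 * INR k + 50) ^ 2 <= (INR k ^ 2 - 3) ^ 2) by (apply pow_incr; lra).
  nra.
Qed.

Lemma rotated_coordinates (i : nat) (x y : R)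
    (a := (x - vx k i) * cos (INR i * turn k) + (y - vy k i) * sin (INR i * turn k))
    (b := - (x - vx k i) * sin (INR i * turn k) + (y - vy k i) * cos (INR i * turn k)) :
  x = vx k i + a * cos (INR i * turn k) - b * sin (INR i * turn k) /\
  y = vy k i + a * sin (INR i * turn k) + b * cos (INR i * turn k).
Proof.
  pose proof (sin2_cos2 (INR i * turn k)) as Hsc; unfold Rsqr in Hsc.
  unfold a, b; split.
  - transitivity (vx k i + (x - vx k i) *
      (sin (INR i * turn k) * sin (INR i * turn k) + cos (INR i * turn k) * cos (INR i * turn k)));
      [rewrite Hsc|]; ring.
  - transitivity (vy k i + (y - vy k i) *
      (sin (INR i * turn k) * sin (INR i * turn k) + cos (INR i * turn k) * cos (INR i * turn k)));
      [rewrite Hsc|]; ring.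
Qed.

(** Rounding the rotated coordinates down leads to a net point and changes [x] and [y] by at most 2.
    With the unit width of a box, the box index moves by at most 3, which is what [d] and [e]
    allow. *)
Lemma lens_cover (i : nat) (x y : R) (p : nat * nat)
    (a := (x - vx k i) * cos (INR i * turn k) + (y - vy k i) * sin (INR i * turn k))
    (b := - (x - vx k i) * sin (INR i * turn k) + (y - vy k i) * cos (INR i * turn k)) :
  Rabs a <= 10 * INR k -> Rabs b <= 14 ->
  INR (fst p) <= x <= INR (fst p) + 1 -> INR (snd p) <= y <= INR (snd p) + 1 ->
  lens_at i p.
Proof.
  intros Ha Hb Hx Hy; apply Rabs_le_inv in Ha; apply Rabs_le_inv in Hb.
  set (j := nfloor (a + 10 * INR k)); set (l := nfloor (b + 14)).
  assert (Hj : INR j <= a + 10 * INR k < INR j + 1) by (apply nfloor_spec; lra).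
  assert (Hl : INR l <= b + 14 < INR l + 1) by (apply nfloor_spec; lra).
  pose proof (COS_bound (INR i * turn k)) as Hc; pose proof (SIN_bound (INR i * turn k)) as Hs.
  pose proof cube_large as H3; pose proof (radius_bounds k k_large) as HR.
  pose proof (vertex_range k k_large i) as HV; unfold centre in HV.
  destruct (rotated_coordinates i x y) as [Ex Ey]; fold a b in Ex, Ey.
  set (u := a - (INR j - 10 * INR k)); set (w := b - (INR l - 14)).
  assert (Hu : 0 <= u <= 1) by (unfold u; lra).
  assert (Hw : 0 <= w <= 1) by (unfold w; lra).
  assert (Dx : x - lens_x i j l = u * cos (INR i * turn k) - w * sin (INR i * turn k)).
  { rewrite Ex at 1; unfold lens_x, u, w; ring. }
  assert (Dy : y - lens_y i j l = u * sin (INR i * turn k) + w * cos (INR i * turn k)).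
  { rewrite Ey at 1; unfold lens_y, u, w; ring. }
  clearbody a b u w.
  set (cc := cos (INR i * turn k)) in *; set (ss := sin (INR i * turn k)) in *.
  assert (Hbox : forall z t q, Rabs (t - z) <= 2 -> INR q <= t <= INR q + 1 -> 0 <= z ->
            (nfloor z <= q + 3)%nat /\ (q + 3 - nfloor z <= 6)%nat).
  { intros z t q Hz Hq Hz0; apply Rabs_le_inv in Hz; destruct (nfloor_spec z Hz0) as [F1 F2].
    split; [|enough (q <= nfloor z + 3)%nat by lia]; apply INR_le; rewrite plus_INR;
      simpl (INR 3); lra. }
  assert (Hxz : Rabs (x - lens_x i j l) <= 2).
  { rewrite Dx; apply Rabs_le.
    pose proof (mult_unit_bounds u cc 1); pose proof (mult_unit_bounds w ss 1); lra. }
  assert (Hyz : Rabs (y - lens_y i j l) <= 2).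
  { rewrite Dy; apply Rabs_le.
    pose proof (mult_unit_bounds u ss 1); pose proof (mult_unit_bounds w cc 1); lra. }
  pose proof (mult_unit_bounds a cc (10 * INR k) Ha Hc) as Hac.
  pose proof (mult_unit_bounds a ss (10 * INR k) Ha Hs) as Has.
  pose proof (mult_unit_bounds b ss 14 Hb Hs) as Hbs.
  pose proof (mult_unit_bounds b cc 14 Hb Hc) as Hbc.
  destruct (Hbox (lens_x i j l) x (fst p)) as [B1 B2];
    [exact Hxz | exact Hx | apply Rabs_le_inv in Hxz; lra |].
  destruct (Hbox (lens_y i j l) y (snd p)) as [B3 B4];
    [exact Hyz | exact Hy | apply Rabs_le_inv in Hyz; lra |].
  exists j, l, (fst p + 3 - nfloor (lens_x i j l))%nat, (snd p + 3 - nfloor (lens_y i j l))%nat.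
  repeat split; [ | | exact B2 | exact B4 | ].
  - apply INR_le; rewrite mult_INR; simpl (INR 20); lra.
  - apply INR_le; simpl (INR 28); lra.
  - unfold lens_box; rewrite (surjective_pairing p) at 1; f_equal; lia.
Qed.

(** The margin 1 is the width of a box: the box of such a point starts at a nonnegative coordinate
    of the window, so the window offset can be subtracted in [nat]. *)
Lemma lens_cover_pos (i : nat) (x y : R)
    (a := (x - vx k i) * cos (INR i * turn k) + (y - vy k i) * sin (INR i * turn k))
    (b := - (x - vx k i) * sin (INR i * turn k) + (y - vy k i) * cos (INR i * turn k)) :
  Rabs a <= 10 * INR k -> Rabs b <= 14 -> 1 <= x /\ 1 <= y.
Proof.
  intros Ha Hb; apply Rabs_le_inv in Ha; apply Rabs_le_inv in Hb.
  pose proof (COS_bound (INR i * turn k)) as Hc; pose proof (SIN_bound (INR i * turn k)) as Hs.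
  pose proof cube_large as H3; pose proof (radius_bounds k k_large) as HR.
  pose proof (vertex_range k k_large i) as HV; unfold centre in HV.
  destruct (rotated_coordinates i x y) as [Ex Ey]; fold a b in Ex, Ey.
  pose proof (mult_unit_bounds a _ (10 * INR k) Ha Hc).
  pose proof (mult_unit_bounds a _ (10 * INR k) Ha Hs).
  pose proof (mult_unit_bounds b _ 14 Hb Hs).
  pose proof (mult_unit_bounds b _ 14 Hb Hc).
  lra.
Qed.

Lemma polygon_box_in_lens (i : nat) : lens_at i (polygon_box k i).
Proof.
  destruct (polygon_box_spec i) as [H1 H2].
  apply lens_cover with (x := vx k i) (y := vy k i); try lra;
    rewrite !Rminus_diag; apply Rabs_le; lra.
Qed.

Lemma lens_boxes_window (p : nat * nat) : In p lens_boxes ->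
  (fst p < 2 * k ^ 3)%nat /\ (snd p < 2 * k ^ 3)%nat.
Proof.
  rewrite in_lens_boxes; intros (i & Hi & Hl).
  destruct (lens_at_near _ _ Hl) as [H1 H2]; apply Rabs_le_inv in H1; apply Rabs_le_inv in H2.
  pose proof cube_large as H3; pose proof (radius_bounds k k_large) as HR.
  pose proof (vertex_range k k_large i) as HV; unfold centre in HV.
  split; apply INR_lt; rewrite mult_INR, pow_INR; simpl (INR 2); lra.
Qed.

Lemma polygon_box_inj (i i' : nat) : (i < k)%nat -> (i' < k)%nat ->
  polygon_box k i = polygon_box k i' -> i = i'.
Proof.
  intros Hi Hi' Heq; apply polygon_box_lens_at; try assumption.
  rewrite Heq; apply polygon_box_in_lens.
Qed.

End Lens.

(** * Escape in a geometric graph that has a suitable window *)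

Lemma dist2_scaled (M a b : R) (p q : R * R) : 0 < M ->
  dist_euc (M * fst p - a) (M * snd p - b) (M * fst q - a) (M * snd q - b) = M * dist2 p q.
Proof.
  intros HM; unfold dist_euc, dist2.
  rewrite <- (sqrt_pow2 M) at 5 by lra.
  rewrite <- sqrt_mult_alt by (apply pow_le; lra).
  f_equal; unfold Rsqr; ring.
Qed.

Lemma step_dist (n : nat) (x : nat -> R * R) (r : R) (u v : nat) :
  0 <= r -> step (vert n) (rgg_adj n x r) u v -> dist2 (x u) (x v) <= r.
Proof.
  intros Hr [_ [->|(_ & _ & _ & Hd)]]; [|exact Hd].
  unfold dist2; rewrite !Rminus_diag.
  replace (0 ^ 2 + 0 ^ 2) with 0 by ring; rewrite sqrt_0; exact Hr.
Qed.

Lemma dist_step (n : nat) (x : nat -> R * R) (r : R) (u v : nat) :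
  (u < n)%nat -> (v < n)%nat -> dist2 (x u) (x v) <= r -> step (vert n) (rgg_adj n x r) u v.
Proof.
  intros Hu Hv Hd; split; [exact Hv|].
  destruct (Nat.eq_dec u v) as [->|Hne]; [left; reflexivity|right; repeat split; assumption].
Qed.

Lemma in_cell_scaled (n m : nat) (c : list (nat * nat)) (x : nat -> R * R) (u : nat) :
  (0 < m)%nat -> in_cell n m c x -> (u < n)%nat ->
  INR (fst (nth u c (0, 0)%nat)) <= INR m * fst (x u) <= INR (fst (nth u c (0, 0)%nat)) + 1 /\
  INR (snd (nth u c (0, 0)%nat)) <= INR m * snd (x u) <= INR (snd (nth u c (0, 0)%nat)) + 1.
Proof.
  intros Hm Hc Hu; apply lt_0_INR in Hm.
  specialize (Hc u Hu); cbv zeta in Hc.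
  destruct (nth u c (0, 0)%nat) as [a b]; simpl fst in *; simpl snd in *.
  rewrite !S_INR in Hc.
  assert (Hdiv : forall z t, z / INR m <= t <-> z <= INR m * t).
  { intros z t; split; intros H.
    - apply (Rmult_le_compat_l (INR m)) in H; [|lra].
      replace (INR m * (z / INR m)) with z in H by (field; lra). exact H.
    - apply Rmult_le_reg_l with (INR m); [lra|].
      replace (INR m * (z / INR m)) with z by (field; lra). exact H. }
  assert (Hdiv' : forall z t, t <= z / INR m <-> INR m * t <= z).
  { intros z t; split; intros H.
    - apply (Rmult_le_compat_l (INR m)) in H; [|lra].
      replace (INR m * (z / INR m)) with z in H by (field; lra). exact H.
    - apply Rmult_le_reg_l with (INR m); [lra|].
      replace (INR m * (z / INR m)) with z by (field; lra). exact H. }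
  rewrite !Hdiv, !Hdiv' in Hc; lra.
Qed.

(** The chosen points form an undominated set. Measured in boxes from the corner of the window, each
    is within [3 / 2] of its polygon vertex. As [side + 3 = k^2 <= m r], consecutive ones are
    adjacent. A vertex adjacent or equal to both neighbours of [g i] is within [k^2 + 1 + 3 / 2] of
    both polygon vertices, hence in the lens at [i], where [g i] is the only point. *)
Lemma polygon_block_evades (k W n m : nat) (r : R) (c : list (nat * nat)) (x : nat -> R * R) :
  (100 <= k)%nat -> (0 < m)%nat -> INR k ^ 2 <= INR m * r <= INR k ^ 2 + 1 ->
  occupies n k W (polygon_box k) (lens_boxes k) c -> in_cell n m c x ->
  cop_number_gt1 (vert n) (rgg_adj n x r).
Proof.
  intros Hk Hm Hr (j1 & j2 & g & Hg & Honly) Hcell.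
  assert (HM : 0 < INR m) by (apply lt_0_INR; exact Hm).
  assert (Hk' : 100 <= INR k).
  { replace 100 with (INR 100) by (simpl; lra). apply le_INR; exact Hk. }
  assert (Hr0 : 0 <= r) by (apply Rmult_le_reg_l with (INR m); nra).
  set (o1 := INR (j1 * W)); set (o2 := INR (j2 * W)).
  set (X := fun u => INR m * fst (x u) - o1); set (Y := fun u => INR m * snd (x u) - o2).
  assert (Hdist : forall u v, dist_euc (X u) (Y u) (X v) (Y v) = INR m * dist2 (x u) (x v)).
  { intros u v; apply dist2_scaled; exact HM. }
  assert (Hgx : forall i, (i < k)%nat -> dist_euc (X (g i)) (Y (g i)) (vx k i) (vy k i) <= 3 / 2).
  { intros i Hi; destruct (Hg i Hi) as [Hgn Hnth].
    destruct (in_cell_scaled n m c x (g i) Hm Hcell Hgn) as [H1 H2].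
    rewrite Hnth in H1, H2; unfold block_shift in H1, H2; simpl fst in H1; simpl snd in H2.
    rewrite plus_INR in H1, H2; fold o1 in H1; fold o2 in H2.
    destruct (polygon_box_spec k Hk i) as [H3 H4].
    unfold polygon_box in H3, H4; simpl fst in H3; simpl snd in H4.
    unfold X, Y; apply dist_euc_le_box; apply Rabs_le; lra. }
  assert (Hstep : forall i i' e, (i < k)%nat -> (i' < k)%nat -> e = turn k \/ e = - turn k ->
            cos (INR i' * turn k) = cos (INR i * turn k + e) ->
            sin (INR i' * turn k) = sin (INR i * turn k + e) ->
            step (vert n) (rgg_adj n x r) (g i) (g i')).
  { intros i i' e Hi Hi' He Hc Hs.
    apply dist_step; [apply Hg; exact Hi | apply Hg; exact Hi' |].
    apply Rmult_le_reg_l with (INR m); [exact HM|]; rewrite <- Hdist.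
    pose proof (adjacent_vertices k Hk i i' e He Hc Hs) as Hside.
    pose proof (Hgx i Hi) as D1; pose proof (Hgx i' Hi') as D2.
    rewrite distance_symm in D2.
    pose proof (triangle (X (g i)) (Y (g i)) (X (g i')) (Y (g i')) (vx k i) (vy k i)) as T1.
    pose proof (triangle (vx k i) (vy k i) (X (g i')) (Y (g i')) (vx k i') (vy k i')) as T2.
    unfold side in Hside; lra. }
  assert (Hlens : forall i i1 i2 u, (i < k)%nat -> (i1 < k)%nat -> (i2 < k)%nat -> (u < n)%nat ->
            cos (INR i1 * turn k) = cos (INR i * turn k + turn k) ->
            sin (INR i1 * turn k) = sin (INR i * turn k + turn k) ->
            cos (INR i2 * turn k) = cos (INR i * turn k - turn k) ->
            sin (INR i2 * turn k) = sin (INR i * turn k - turn k) ->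
            dist2 (x u) (x (g i1)) <= r -> dist2 (x u) (x (g i2)) <= r -> u = g i).
  { intros i i1 i2 u Hi Hi1 Hi2 Hu C1 S1 C2 S2 D1 D2.
    apply (Rmult_le_compat_l (INR m)) in D1, D2; try lra.
    rewrite <- Hdist in D1, D2.
    assert (F1 : dist_euc (X u) (Y u) (vx k i1) (vy k i1) <= INR k ^ 2 + 5 / 2).
    { pose proof (triangle (X u) (Y u) (vx k i1) (vy k i1) (X (g i1)) (Y (g i1))).
      pose proof (Hgx i1 Hi1); lra. }
    assert (F2 : dist_euc (X u) (Y u) (vx k i2) (vy k i2) <= INR k ^ 2 + 5 / 2).
    { pose proof (triangle (X u) (Y u) (vx k i2) (vy k i2) (X (g i2)) (Y (g i2))).
      pose proof (Hgx i2 Hi2); lra. }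
    assert (Hrho : 0 <= INR k ^ 2 + 5 / 2 <= INR k ^ 2 + 5 / 2) by nra.
    destruct (lens_bounds k Hk i i1 i2 (X u) (Y u) _ C1 S1 C2 S2 Hrho F1 F2) as [Ha Hb].
    destruct (in_cell_scaled n m c x u Hm Hcell Hu) as [H1 H2].
    destruct (nth u c (0, 0)%nat) as [A1 A2] eqn:HA; simpl fst in H1; simpl snd in H2.
    assert (Hpos : 1 <= X u /\ 1 <= Y u).
    { pose proof (lens_cover_pos k Hk i (X u) (Y u) Ha Hb). lra. }
    assert (L1 : (j1 * W <= A1)%nat).
    { apply INR_le; fold o1; unfold X in Hpos; lra. }
    assert (L2 : (j2 * W <= A2)%nat).
    { apply INR_le; fold o2; unfold Y in Hpos; lra. }
    set (p := (A1 - j1 * W, A2 - j2 * W)%nat).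
    assert (Hp : lens_at k i p).
    { apply lens_cover with (x := X u) (y := Y u); try assumption;
        unfold p, X, Y; simpl fst; simpl snd; rewrite minus_INR by assumption;
        fold o1; fold o2; lra. }
    assert (HpQ : In p (lens_boxes k)) by (apply (in_lens_boxes k); exists i; auto).
    assert (Hsh : nth u c (0, 0)%nat = block_shift W j1 j2 p).
    { rewrite HA; unfold block_shift, p; simpl fst; simpl snd; f_equal; lia. }
    (* The boxes of all lenses are reserved for chosen points, so [u] is some [g i']; its box lies
       in the lens at [i], which forces [i' = i]. *)
    destruct (Honly u p Hu HpQ Hsh) as (i' & Hi' & ->).
    destruct (Hg i' Hi') as [_ Hnth].
    rewrite Hsh in Hnth; unfold block_shift in Hnth; injection Hnth as E1 E2.
    assert (Hpp : p = polygon_box k i').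
    { rewrite (surjective_pairing p), (surjective_pairing (polygon_box k i')).
      f_equal; unfold polygon_box in *; simpl fst in *; simpl snd in *; lia. }
    rewrite Hpp in Hp; f_equal; apply (polygon_box_lens_at k Hk); assumption. }
  apply undominated_set_evades with (S := fun v => exists i, (i < k)%nat /\ v = g i).
  - intros v (i & Hi & ->); apply Hg; exact Hi.
  - exists (g 0%nat), (g 1%nat); repeat split;
      [exists 0%nat; split; [lia|reflexivity] | exists 1%nat; split; [lia|reflexivity] |].
    intros Heq.
    destruct (Hg 0%nat ltac:(lia)) as [_ N0]; destruct (Hg 1%nat ltac:(lia)) as [_ N1].
    rewrite Heq, N1 in N0; unfold block_shift in N0; injection N0 as E1 E2.
    assert (H10 : 1%nat = 0%nat); [|discriminate].
    apply (polygon_box_inj k Hk); [lia|lia|].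
    unfold polygon_box in *; simpl fst in *; simpl snd in *; f_equal; lia.
  - intros v u (i & Hi & ->) Hu Hne.
    destruct (next_vertex k Hk i Hi) as (i1 & Hi1 & C1 & S1).
    destruct (prev_vertex k Hk i Hi) as (i2 & Hi2 & C2 & S2).
    (* The robber prefers the next vertex of the polygon; if the cop dominates that one, it cannot
       dominate the previous one too. *)
    destruct (Rle_dec (dist2 (x u) (x (g i1))) r) as [D1|D1].
    + exists (g i2); split; [exists i2; auto|]. split.
      * apply (Hstep i i2 (- turn k)); auto.
      * intros Hs; apply step_dist in Hs; [|exact Hr0].
        apply Hne; exact (Hlens i i1 i2 u Hi Hi1 Hi2 Hu C1 S1 C2 S2 D1 Hs).
    + exists (g i1); split; [exists i1; auto|]. split.
      * apply (Hstep i i1 (turn k)); auto.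
      * intros Hs; apply step_dist in Hs; [|exact Hr0]. exact (D1 Hs).
Qed.

Definition isolating_boxes : list (nat * nat) := list_prod (seq 0 3) (seq 0 3).

(** A point within [r] of the one in the central box differs from it by less than a box in each
    coordinate, so it lies in the 3 by 3 window and is that point itself. *)
Lemma isolated_block_evades (n m : nat) (r : R) (c : list (nat * nat)) (x : nat -> R * R) :
  (2 <= n)%nat -> (0 < m)%nat -> INR m * r < 1 ->
  occupies n 1 3 (fun _ => (1, 1)%nat) isolating_boxes c -> in_cell n m c x ->
  cop_number_gt1 (vert n) (rgg_adj n x r).
Proof.
  intros Hn Hm Hr (j1 & j2 & g & Hg & Honly) Hcell.
  assert (HM : 0 < INR m) by (apply lt_0_INR; exact Hm).
  destruct (Hg 0%nat ltac:(lia)) as [Hgn Hnth].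
  destruct (in_cell_scaled n m c x (g 0%nat) Hm Hcell Hgn) as [H1 H2].
  rewrite Hnth in H1, H2; unfold block_shift in H1, H2; simpl fst in H1; simpl snd in H2.
  rewrite plus_INR in H1, H2; simpl (INR 1) in H1, H2.
  assert (Hiso : forall u, (u < n)%nat -> dist2 (x u) (x (g 0%nat)) <= r -> u = g 0%nat).
  { intros u Hu Hd.
    destruct (in_cell_scaled n m c x u Hm Hcell Hu) as [H3 H4].
    assert (Hd' : dist_euc (INR m * fst (x u) - 0) (INR m * snd (x u) - 0)
               (INR m * fst (x (g 0%nat)) - 0) (INR m * snd (x (g 0%nat)) - 0) <= INR m * r).
    { rewrite dist2_scaled by exact HM; apply Rmult_le_compat_l; lra. }
    assert (Hsq := dist_euc_le _ _ _ _ _ Hd').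
    assert (Hr0 : 0 <= INR m * r).
    { eapply Rle_trans; [|exact Hd']; apply sqrt_pos. }
    set (dx := INR m * fst (x u) - INR m * fst (x (g 0%nat))).
    set (dy := INR m * snd (x u) - INR m * snd (x (g 0%nat))).
    replace (INR m * fst (x u) - 0 - (INR m * fst (x (g 0%nat)) - 0)) with dx in Hsq
      by (unfold dx; ring).
    replace (INR m * snd (x u) - 0 - (INR m * snd (x (g 0%nat)) - 0)) with dy in Hsq
      by (unfold dy; ring).
    assert (Hdx : -1 < dx < 1) by (split; nra).
    assert (Hdy : -1 < dy < 1) by (split; nra).
    unfold dx in Hdx; unfold dy in Hdy.
    destruct (nth u c (0, 0)%nat) as [A1 A2] eqn:HA; simpl fst in H3; simpl snd in H4.
    (* Boxes are closed and share their boundaries; the strict inequality [m r < 1] excludes the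
       boxes just outside the window. *)
    assert (L1 : (j1 * 3 <= A1 < j1 * 3 + 3)%nat).
    { split; [apply Nat.lt_succ_r|]; apply INR_lt; rewrite ?S_INR, ?plus_INR; simpl (INR 3); lra. }
    assert (L2 : (j2 * 3 <= A2 < j2 * 3 + 3)%nat).
    { split; [apply Nat.lt_succ_r|]; apply INR_lt; rewrite ?S_INR, ?plus_INR; simpl (INR 3); lra. }
    destruct (Honly u (A1 - j1 * 3, A2 - j2 * 3)%nat Hu) as (i & Hi & ->).
    - unfold isolating_boxes; apply in_prod; apply in_seq; lia.
    - rewrite HA; unfold block_shift; simpl fst; simpl snd; f_equal; lia.
    - f_equal; lia. }
  set (w := if Nat.eq_dec (g 0%nat) 0 then 1%nat else 0%nat).
  apply isolated_vertex_evades with (v := g 0%nat) (w := w).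
  - exact Hgn.
  - unfold w, vert; destruct (Nat.eq_dec (g 0%nat) 0); lia.
  - unfold w; destruct (Nat.eq_dec (g 0%nat) 0); lia.
  - intros u (Hu & _ & Hne & Hd); exact (Hne (Hiso u Hu Hd)).
  - intros u (_ & Hu & Hne & Hd); apply Hne; symmetry; apply Hiso; [exact Hu|].
    unfold dist2 in *.
    replace ((fst (x u) - fst (x (g 0%nat))) ^ 2 + (snd (x u) - snd (x (g 0%nat))) ^ 2)
      with ((fst (x (g 0%nat)) - fst (x u)) ^ 2 + (snd (x (g 0%nat)) - snd (x u)) ^ 2) by ring.
    exact Hd.
Qed.

(** * Estimates for exponentials and logarithms *)

Lemma prob_ge_weaken (n : nat) (E : (nat -> R * R) -> Prop) (p p' : R) :
  p' <= p -> prob_ge n E p -> prob_ge n E p'.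
Proof.
  intros Hp (m & L & Hm & HL & HF & Hge); exists m, L; repeat split; try assumption; lra.
Qed.

Lemma exp_nat_mult (x : R) (n : nat) : exp x ^ n = exp (INR n * x).
Proof.
  induction n as [|n IH]; [simpl; rewrite Rmult_0_l, exp_0; reflexivity|].
  rewrite S_INR; simpl pow; rewrite IH, <- exp_plus; f_equal; ring.
Qed.

(** For [q <= 1/2] one has [(1 - q) * (1 + 2 q) >= 1], hence [1 - q >= exp (- 2 q)]. *)
Lemma one_minus_pow_ge (q : R) (n : nat) : 0 <= q <= / 2 -> exp (- (2 * q * INR n)) <= (1 - q) ^ n.
Proof.
  intros Hq.
  replace (- (2 * q * INR n)) with (INR n * (- (2 * q))) by ring.
  rewrite <- exp_nat_mult; apply pow_incr; split; [left; apply exp_pos|].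
  rewrite exp_Ropp.
  assert (He : 1 + 2 * q <= exp (2 * q)).
  { destruct (Req_dec q 0) as [->|Hne]; [rewrite Rmult_0_r, exp_0; lra|].
    left; apply exp_ineq1; lra. }
  apply Rmult_le_reg_l with (exp (2 * q)); [apply exp_pos|].
  rewrite Rinv_r by (apply Rgt_not_eq, exp_pos).
  nra.
Qed.

(** Used to absorb powers of [ln n] into small powers of [n]. *)
Lemma exp_ge_square (x : R) : 0 < x -> x ^ 2 / 4 <= exp x.
Proof.
  intros Hx; replace x with (x / 2 + x / 2) at 2 by field.
  rewrite exp_plus; assert (H : 1 + x / 2 < exp (x / 2)) by (apply exp_ineq1; lra); nra.
Qed.

Lemma ln_eventually_ge (L : R) : exists N : nat, forall n, (N <= n)%nat -> (2 <= n)%nat /\ L <= ln (INR n).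
Proof.
  pose proof (nfloor_spec (exp L) (Rlt_le _ _ (exp_pos L))) as HN.
  exists (nfloor (exp L) + 2)%nat; intros n Hn; split; [lia|].
  rewrite <- (ln_exp L); left; apply ln_increasing; [apply exp_pos|].
  apply le_INR in Hn; rewrite plus_INR in Hn; simpl (INR 2) in Hn; lra.
Qed.

Lemma INR_div_ge (m d : nat) : (0 < d)%nat -> INR m / INR d - 1 <= INR (m / d).
Proof.
  intros Hd; assert (Hd' : 0 < INR d) by (apply lt_0_INR; exact Hd).
  assert (Hlt : INR m <= INR d * (INR (m / d) + 1)).
  { rewrite <- S_INR, <- mult_INR; apply le_INR.
    pose proof (Nat.mul_succ_div_gt m d ltac:(lia)); lia. }
  apply Rmult_le_reg_l with (INR d); [exact Hd'|].
  replace (INR d * (INR m / INR d - 1)) with (INR m - INR d) by (field; lra); lra.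
Qed.

(** * The two ranges of [r] *)

(** The mesh depends on [n] alone. Nine boxes have mass [q <= l / (4 n)], so a window stays free of
    other points with probability at least [exp (- l / 2)], which is [1 / h] with [h = sqrt n]; the
    mean is then at least [h / 72]. *)
Lemma isolated_regime (n : nat) (r eps : R) (l := ln (INR n)) :
  0 < eps -> (2 <= n)%nat -> 2304 / eps + 100000000 <= l -> 0 < r ->
  8 * r * sqrt (INR n / l) <= 1 ->
  prob_ge n (fun x => cop_number_gt1 (vert n) (rgg_adj n x r)) (1 - eps).
Proof.
  intros Heps Hn Hl Hr Hrs.
  assert (Hl0 : 100000000 <= l) by (assert (0 < 2304 / eps) by (apply Rdiv_lt_0_compat; lra); lra).
  assert (Hle : 2304 <= l * eps).
  { apply Rmult_le_reg_r with (/ eps); [apply Rinv_0_lt_compat; lra|].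
    replace (l * eps * / eps) with l by (field; lra). unfold Rdiv in Hl; lra. }
  assert (Hn' : 2 <= INR n) by (apply (le_INR 2); exact Hn).
  assert (Hexp : INR n = exp l) by (unfold l; rewrite exp_ln; lra).
  set (h := exp (l / 2)).
  assert (Hh : INR n = h * h).
  { rewrite Hexp; unfold h; rewrite <- exp_plus; f_equal; field. }
  assert (Hhl : (l / 2) ^ 2 / 4 <= h) by (apply exp_ge_square; lra).
  assert (Hh1 : l <= h) by nra.
  set (s := sqrt (INR n / l)) in *.
  assert (Hs2 : s * s = INR n / l) by (apply sqrt_sqrt, Rle_mult_inv_pos; lra).
  assert (Hs0 : 0 <= s) by apply sqrt_pos.
  assert (Hs1 : 1 <= s).
  { apply Rsqr_incr_0; [|lra|lra]. unfold Rsqr; rewrite Hs2.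
    apply Rmult_le_reg_r with l; [lra|].
    replace (INR n / l * l) with (INR n) by (field; lra). nra. }
  (* The factor 6 makes [q] small enough, while [m <= 7 s] and [8 r s <= 1] keep [m r] below 1. *)
  set (m := S (nfloor (6 * s))).
  assert (Hm : 6 * s <= INR m <= 7 * s).
  { pose proof (nfloor_spec (6 * s) ltac:(lra)); unfold m; rewrite S_INR; lra. }
  assert (Hm0 : (0 < m)%nat) by (unfold m; lia).
  set (q := INR (length isolating_boxes) / INR m ^ 2).
  assert (Hq : 0 <= q <= l / (4 * INR n)).
  { unfold q; simpl length; replace (INR 9) with 9 by (simpl; ring).
    split; [apply Rle_mult_inv_pos; [lra|apply pow_lt; lra]|].
    replace (l / (4 * INR n)) with (9 / (6 * s) ^ 2).
    2:{ replace ((6 * s) ^ 2) with (36 * (s * s)) by ring; rewrite Hs2; field; lra. }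
    apply Rmult_le_compat_l; [lra|].
    apply Rinv_le_contravar; [apply pow_lt; lra|]. apply pow_incr; lra. }
  assert (Hqn : 2 * q * INR n <= l / 2).
  { replace (l / 2) with (2 * (l / (4 * INR n)) * INR n) by (field; lra).
    apply Rmult_le_compat_r; lra. }
  assert (Hql : q * l <= 1 / 4).
  { apply Rle_trans with (l / (4 * INR n) * l); [apply Rmult_le_compat_r; lra|].
    apply Rmult_le_reg_r with (4 * INR n); [lra|].
    replace (l / (4 * INR n) * l * (4 * INR n)) with (l * l) by (field; lra). rewrite Hh; nra. }
  assert (Hq2 : q <= / 2) by nra.
  set (B := (m / 3)%nat).
  assert (HB : INR m / 6 <= INR B).
  { pose proof (INR_div_ge m 3 ltac:(lia)) as Hd; fold B in Hd; simpl (INR 3) in Hd.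
    replace (1 + 1 + 1) with 3 in Hd by ring. lra. }
  set (mu := INR B ^ 2 * INR (n - 1) ^ 1 * (1 - q) ^ n / (INR m ^ 2) ^ 1).
  assert (Hmu : h / 72 <= mu).
  { assert (Hpow : / h <= (1 - q) ^ n).
    { apply Rle_trans with (exp (- (2 * q * INR n))); [|apply one_minus_pow_ge; lra].
      unfold h; rewrite <- exp_Ropp.
      destruct (Rle_lt_or_eq_dec _ _ Hqn) as [Hlt|Heq]; [left; apply exp_increasing; lra|].
      rewrite Heq; lra. }
    assert (Hh0 : 0 < h) by lra.
    assert (Hinv : 0 < / h) by (apply Rinv_0_lt_compat; lra).
    assert (Hn1 : INR n / 2 <= INR (n - 1)).
    { rewrite minus_INR by lia; simpl (INR 1); lra. }
    assert (HB2 : (INR m / 6) ^ 2 <= INR B ^ 2) by (apply pow_incr; lra).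
    assert (HmR : 0 < INR m ^ 2) by (apply pow_lt; lra).
    apply Rle_trans with ((INR m / 6) ^ 2 * (INR n / 2) * / h / INR m ^ 2).
    - right; rewrite Hh; field; lra.
    - unfold mu; rewrite !pow_1; apply Rmult_le_compat_r; [left; apply Rinv_0_lt_compat; exact HmR|].
      assert (0 <= (INR m / 6) ^ 2) by apply pow2_ge_0.
      apply Rmult_le_compat; [nra|lra| |exact Hpow].
      apply Rmult_le_compat; lra. }
  apply prob_ge_weaken with (1 - 2 * INR 1 * q - 1 / mu).
  - simpl (INR 1).
    assert (Hinv : 1 / mu <= eps / 2).
    { apply Rle_trans with (1 / (h / 72)).
      - apply Rmult_le_compat_l; [lra|]; apply Rinv_le_contravar; lra.
      - apply Rmult_le_reg_r with h; [lra|].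
        replace (1 / (h / 72) * h) with 72 by (field; lra). nra. }
    assert (q <= eps / 4) by nra. lra.
  - apply (occupied_probability n m 1 3 B (fun _ => (1, 1)%nat) isolating_boxes).
    + exact Hm0.
    + unfold isolating_boxes; simpl; repeat constructor; simpl; intuition discriminate.
    + intros p Hp; unfold isolating_boxes in Hp; rewrite (surjective_pairing p) in Hp.
      apply in_prod_iff in Hp; rewrite !in_seq in Hp; lia.
    + intros i _; unfold isolating_boxes; apply in_prod; apply in_seq; lia.
    + intros i i' Hi Hi' _; lia.
    + unfold B; pose proof (Nat.div_mod_eq m 3); lia.
    + lia.
    + exact Hq2.
    + apply Rlt_le_trans with (h / 72); [lra|exact Hmu].
    + intros c x _ Ho Hc; apply (isolated_block_evades n m r c x); try assumption.
      apply Rle_lt_trans with (7 * s * r); [apply Rmult_le_compat_r; lra|]. nra.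
Qed.

(** With [k] about [sqrt l] and [m] about [k^2 / r], the mean is a product of three factors: [B^2]
    windows, a factor [(n - k) / m^2] for each of the [k] chosen points, and the probability that
    the lenses are otherwise empty. All losses are measured against [v = n^(1/4)]. *)
Lemma polygon_regime (n : nat) (r eps : R) (l := ln (INR n)) :
  0 < eps -> (2 <= n)%nat -> 2304 / eps + 100000000 <= l -> 0 < r ->
  r <= / 600 * l / sqrt (INR n) -> 1 < 8 * r * sqrt (INR n / l) ->
  prob_ge n (fun x => cop_number_gt1 (vert n) (rgg_adj n x r)) (1 - eps).
Proof.
  intros Heps Hn Hl Hr Hru Hrs.
  assert (Hl0 : 100000000 <= l) by (assert (0 < 2304 / eps) by (apply Rdiv_lt_0_compat; lra); lra).
  assert (Hle : 2304 <= l * eps).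
  { apply Rmult_le_reg_r with (/ eps); [apply Rinv_0_lt_compat; lra|].
    replace (l * eps * / eps) with l by (field; lra). unfold Rdiv in Hl; lra. }
  assert (Hn' : 2 <= INR n) by (apply (le_INR 2); exact Hn).
  assert (Hexp : INR n = exp l) by (unfold l; rewrite exp_ln; lra).
  set (h := exp (l / 2)).
  assert (Hh : INR n = h * h).
  { rewrite Hexp; unfold h; rewrite <- exp_plus; f_equal; field. }
  assert (Hh0 : 0 < h) by apply exp_pos.
  assert (Hhl : l ^ 2 / 16 <= h).
  { replace (l ^ 2 / 16) with ((l / 2) ^ 2 / 4) by field. apply exp_ge_square; lra. }
  assert (Hsq : sqrt (INR n) = h) by (rewrite Hh; apply sqrt_square; lra).
  rewrite Hsq in Hru.
  assert (Hrh : 600 * (r * h) <= l).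
  { apply (Rmult_le_compat_r h) in Hru; [|lra].
    replace (/ 600 * l / h * h) with (/ 600 * l) in Hru by (field; lra). lra. }
  assert (Hrlow : l <= 64 * (r * h) ^ 2).
  { assert (Hs2 : sqrt (INR n / l) * sqrt (INR n / l) = INR n / l)
      by (apply sqrt_sqrt, Rle_mult_inv_pos; lra).
    set (s := sqrt (INR n / l)) in *.
    assert (H1 : 1 <= (8 * r * s) * (8 * r * s)) by nra.
    replace ((8 * r * s) * (8 * r * s)) with (64 * r ^ 2 * (s * s)) in H1 by ring.
    rewrite Hs2, Hh in H1.
    apply (Rmult_le_compat_r l) in H1; [|lra].
    replace (64 * r ^ 2 * (h * h / l) * l) with (64 * (r * h) ^ 2) in H1 by (field; lra). lra. }
  set (w := sqrt l).
  assert (Hw2 : w * w = l) by (apply sqrt_sqrt; lra).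
  (* The threshold [10^8] for [l] serves to place [k] above 6400, as [K <= exp (K / 40)] requires
     below. *)
  assert (Hw0 : 10000 <= w).
  { unfold w; rewrite <- (sqrt_square 10000) by lra. apply sqrt_le_1_alt; lra. }
  set (k := S (nfloor w)).
  assert (Hk : w < INR k <= w + 1).
  { pose proof (nfloor_spec w ltac:(lra)); unfold k; rewrite S_INR; lra. }
  assert (Hk100 : (100 <= k)%nat).
  { apply INR_le; replace (INR 100) with 100 by (simpl; ring); lra. }
  clearbody k.
  set (K := INR k) in *.
  assert (HlK : l <= K ^ 2) by nra.
  assert (HKl : K ^ 2 <= 2 * l) by nra.
  assert (HK2l : K <= l) by nra.
  assert (Hlh : l * 1000 <= h) by nra.
  assert (Hr1 : r <= 1).
  { apply Rmult_le_reg_r with h; [lra|]; lra. }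
  assert (Hpos : 0 < K ^ 2 / r) by (apply Rdiv_lt_0_compat; [apply pow_lt; lra | exact Hr]).
  (* Rounding up keeps [m r >= k^2], and [r <= 1] keeps [m r <= k^2 + 1]. *)
  set (m := S (nfloor (K ^ 2 / r))).
  assert (Hm : K ^ 2 / r <= INR m <= K ^ 2 / r + 1).
  { pose proof (nfloor_spec (K ^ 2 / r) ltac:(lra)); unfold m; rewrite S_INR; lra. }
  assert (Hm0 : (0 < m)%nat) by (unfold m; lia).
  clearbody m.
  set (M := INR m) in *.
  assert (HMr : K ^ 2 <= M * r <= K ^ 2 + r).
  { replace (K ^ 2) with (K ^ 2 / r * r) by (field; lra).
    replace (K ^ 2 / r * r + r) with ((K ^ 2 / r + 1) * r) by ring.
    split; apply Rmult_le_compat_r; lra. }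
  assert (HM0 : 0 < M) by lra.
  set (q := INR (length (lens_boxes k)) / M ^ 2).
  (* The constant [1 / 600] is fixed here: [600^2] exceeds [8 * 30000], where 30000 comes from the
     number of lens boxes. *)
  assert (Hq : 0 <= q <= l / (8 * INR n)).
  { unfold q; split; [apply Rle_mult_inv_pos; [apply pos_INR|apply pow_lt; lra]|].
    apply Rmult_le_reg_r with (M ^ 2 * (8 * INR n)).
    { apply Rmult_lt_0_compat; [apply pow_lt; lra|lra]. }
    replace (INR (length (lens_boxes k)) / M ^ 2 * (M ^ 2 * (8 * INR n)))
      with (INR (length (lens_boxes k)) * (8 * INR n)) by (field; lra).
    replace (l / (8 * INR n) * (M ^ 2 * (8 * INR n))) with (l * M ^ 2) by (field; lra).
    apply Rmult_le_reg_r with (r ^ 2); [apply pow_lt; exact Hr|].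
    pose proof (length_lens_boxes k Hk100) as Hlen; fold K in Hlen.
    apply Rle_trans with (30000 * K ^ 2 * 8 * (r * h) ^ 2).
    - replace (INR (length (lens_boxes k)) * (8 * INR n) * r ^ 2)
        with (INR (length (lens_boxes k)) * (8 * (r * h) ^ 2)) by (rewrite Hh; ring).
      replace (30000 * K ^ 2 * 8 * (r * h) ^ 2) with (30000 * K ^ 2 * (8 * (r * h) ^ 2)) by ring.
      apply Rmult_le_compat_r; [|exact Hlen]. pose proof (pow2_ge_0 (r * h)); lra.
    - replace (l * M ^ 2 * r ^ 2) with (l * (M * r) ^ 2) by ring.
      assert (Hrh2 : (600 * (r * h)) ^ 2 <= l ^ 2) by (apply pow_incr; nra).
      assert (HMr2 : (K ^ 2) ^ 2 <= (M * r) ^ 2) by (apply pow_incr; nra).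
      apply Rle_trans with (K ^ 2 * l ^ 2).
      + replace (30000 * K ^ 2 * 8 * (r * h) ^ 2) with (K ^ 2 * (240000 * (r * h) ^ 2)) by ring.
        apply Rmult_le_compat_l; [nra|].
        replace ((600 * (r * h)) ^ 2) with (360000 * (r * h) ^ 2) in Hrh2 by ring.
        pose proof (pow2_ge_0 (r * h)); lra.
      + apply Rle_trans with (l * (K ^ 2) ^ 2); [|apply Rmult_le_compat_l; lra].
        replace (K ^ 2 * l ^ 2) with (l * (K ^ 2 * l)) by ring.
        replace (l * (K ^ 2) ^ 2) with (l * (K ^ 2 * K ^ 2)) by ring.
        apply Rmult_le_compat_l; [lra|]. apply Rmult_le_compat_l; lra. }
  assert (Hqn : 2 * q * INR n <= l / 4).
  { replace (l / 4) with (2 * (l / (8 * INR n)) * INR n) by (field; lra).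
    apply Rmult_le_compat_r; lra. }
  assert (Hqh : q * (h * 8) <= 1).
  { apply Rle_trans with (l / (8 * INR n) * (h * 8)); [apply Rmult_le_compat_r; lra|].
    rewrite Hh; replace (l / (8 * (h * h)) * (h * 8)) with (l / h) by (field; lra).
    apply Rmult_le_reg_r with h; [lra|]. replace (l / h * h) with l by (field; lra). lra. }
  assert (Hq2 : q <= / 2) by (apply Rmult_le_reg_r with (h * 8); lra).
  assert (HKexp : K <= exp (K / 40)).
  { apply Rle_trans with ((K / 40) ^ 2 / 4); [|apply exp_ge_square; lra].
    replace ((K / 40) ^ 2 / 4) with (K * (K / 6400)) by field.
    rewrite <- (Rmult_1_r K) at 1; apply Rmult_le_compat_l; lra. }
  assert (HlK2 : K ^ 2 / 2 <= l) by lra.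
  (* [K^(5 k) <= exp (K^2 / 8) <= exp (l / 4)], so every power of [K] that occurs costs at most a
     factor [v]. *)
  assert (HKpow : forall e, (e <= 5 * k)%nat -> K ^ e <= exp (l / 4)).
  { intros e He; apply Rle_trans with (K ^ (5 * k)); [apply Rle_pow; [lra|exact He]|].
    apply Rle_trans with (exp (K / 40) ^ (5 * k)); [apply pow_incr; lra|].
    rewrite exp_nat_mult, mult_INR; simpl (INR 5); fold K.
    replace ((1 + 1 + 1 + 1 + 1) * K * (K / 40)) with (K ^ 2 / 2 / 4) by field.
    destruct (Rle_lt_or_eq_dec _ _ HlK2) as [Hlt|Heq]; [left; apply exp_increasing; lra|].
    rewrite Heq; lra. }
  assert (Hhh : h = exp (l / 4) * exp (l / 4)).
  { unfold h; rewrite <- exp_plus; f_equal; field. }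
  set (v := exp (l / 4)) in *.
  assert (Hv0 : 0 < v) by apply exp_pos.
  assert (Hv1 : 1 <= v) by (apply Rle_trans with (K ^ 0); [simpl; lra|apply HKpow; lia]).
  assert (HK6 : K ^ 6 <= v) by (apply HKpow; lia).
  assert (HK3 : 0 < K ^ 3) by (apply pow_lt; lra).
  set (B := (m / (2 * k ^ 3))%nat).
  assert (HW : (0 < 2 * k ^ 3)%nat).
  { assert (k ^ 3 <> 0)%nat by (apply Nat.pow_nonzero; lia). lia. }
  assert (HMK : 4 * K ^ 3 <= M).
  { apply Rmult_le_reg_r with r; [exact Hr|].
    apply Rle_trans with (K ^ 2); [|lra].
    apply Rmult_le_reg_r with h; [lra|].
    replace (4 * K ^ 3 * r * h) with (4 * K ^ 3 * (r * h)) by ring.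
    apply Rle_trans with (4 * K ^ 3 * l); [apply Rmult_le_compat_l; lra|].
    apply Rle_trans with (4 * K ^ 3 * K ^ 2); [apply Rmult_le_compat_l; lra|].
    replace (4 * K ^ 3 * K ^ 2) with (K ^ 2 * (4 * K ^ 3)) by ring.
    apply Rmult_le_compat_l; [nra|].
    apply Rle_trans with v; [|nra].
    apply Rle_trans with (K ^ 6); [|exact HK6].
    replace (K ^ 6) with (K ^ 3 * K ^ 3) by ring.
    apply Rmult_le_compat_r; [lra|].
    apply Rle_trans with (K ^ 1); [lra|apply Rle_pow; [lra|lia]]. }
  assert (HB : M / (4 * K ^ 3) <= INR B).
  { pose proof (INR_div_ge m (2 * k ^ 3) HW) as Hd; fold B in Hd.
    rewrite mult_INR, pow_INR in Hd; fold K in Hd; fold M in Hd; simpl (INR 2) in Hd.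
    apply Rle_trans with (2 := Hd).
    apply Rmult_le_reg_r with (4 * K ^ 3); [lra|].
    replace (M / (4 * K ^ 3) * (4 * K ^ 3)) with M by (field; lra).
    replace ((M / ((1 + 1) * K ^ 3) - 1) * (4 * K ^ 3)) with (2 * M - 4 * K ^ 3) by (field; lra).
    lra. }
  assert (HB2 : INR n / K ^ 6 <= INR B ^ 2).
  { apply Rle_trans with ((M / (4 * K ^ 3)) ^ 2).
    2:{ apply pow_incr; split; [|exact HB]. apply Rle_mult_inv_pos; lra. }
    apply Rmult_le_reg_r with (16 * K ^ 6 * r ^ 2).
    { apply Rmult_lt_0_compat; [assert (0 < K ^ 6) by (apply pow_lt; lra); lra|apply pow_lt; exact Hr]. }
    replace ((M / (4 * K ^ 3)) ^ 2 * (16 * K ^ 6 * r ^ 2)) with ((M * r) ^ 2) by (field; lra).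
    replace (INR n / K ^ 6 * (16 * K ^ 6 * r ^ 2)) with (16 * (r * h) ^ 2) by (rewrite Hh; field; lra).
    apply Rle_trans with ((K ^ 2) ^ 2); [|apply pow_incr; nra].
    apply Rle_trans with (l ^ 2); [|apply pow_incr; lra].
    assert (Hrh2 : (600 * (r * h)) ^ 2 <= l ^ 2) by (apply pow_incr; nra).
    replace ((600 * (r * h)) ^ 2) with (360000 * (r * h) ^ 2) in Hrh2 by ring.
    pose proof (pow2_ge_0 (r * h)); lra. }
  assert (Hkn : K <= INR n / 2).
  { rewrite Hh; assert (2 * h <= h * h) by (apply Rmult_le_compat_r; lra). lra. }
  assert (Hkn' : (2 * k <= n)%nat).
  { apply INR_le; rewrite mult_INR; fold K; simpl (INR 2); lra. }
  (* The lower bound on [r] enters here: it makes [(r h)^2] large, so that a box is not too small to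
     be hit. *)
  assert (Hden : / K ^ 4 <= INR (n - k) / M ^ 2).
  { assert (HK4 : 0 < K ^ 4) by (apply pow_lt; lra).
    assert (HM2 : 0 < M ^ 2) by (apply pow_lt; lra).
    rewrite minus_INR by lia; fold K.
    apply Rmult_le_reg_r with (K ^ 4 * M ^ 2); [nra|].
    replace (/ K ^ 4 * (K ^ 4 * M ^ 2)) with (M ^ 2) by (field; lra).
    replace ((INR n - K) / M ^ 2 * (K ^ 4 * M ^ 2)) with ((INR n - K) * K ^ 4) by (field; lra).
    apply Rmult_le_reg_r with (r ^ 2); [apply pow_lt; exact Hr|].
    replace (M ^ 2 * r ^ 2) with ((M * r) ^ 2) by ring.
    apply Rle_trans with ((2 * K ^ 2) ^ 2); [apply pow_incr; split; lra|].
    apply Rle_trans with (INR n / 2 * K ^ 4 * r ^ 2).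
    2:{ apply Rmult_le_compat_r; [apply pow2_ge_0|]. apply Rmult_le_compat_r; lra. }
    replace (INR n / 2 * K ^ 4 * r ^ 2) with (K ^ 4 * ((r * h) ^ 2 / 2)) by (rewrite Hh; field).
    replace ((2 * K ^ 2) ^ 2) with (K ^ 4 * 4) by ring.
    apply Rmult_le_compat_l; lra. }
  set (mu := INR B ^ 2 * INR (n - k) ^ k * (1 - q) ^ n / (M ^ 2) ^ k).
  assert (Hmu : v <= mu).
  { assert (Hpow : / v <= (1 - q) ^ n).
    { apply Rle_trans with (exp (- (2 * q * INR n))); [|apply one_minus_pow_ge; lra].
      unfold v; rewrite <- exp_Ropp.
      destruct (Rle_lt_or_eq_dec _ _ Hqn) as [Hlt|Heq]; [left; apply exp_increasing; lra|].
      rewrite Heq; lra. }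
    assert (HM2k : 0 < (M ^ 2) ^ k) by (apply pow_lt, pow_lt; lra).
    assert (HK4k : K ^ (4 * k) * K ^ 6 <= v).
    { rewrite <- pow_add; apply HKpow; lia. }
    assert (HK4k0 : 0 < K ^ (4 * k)) by (apply pow_lt; lra).
    assert (HK60 : 0 < K ^ 6) by (apply pow_lt; lra).
    assert (Hinv0 : 0 < / K ^ (4 * k)) by (apply Rinv_0_lt_compat; exact HK4k0).
    assert (Hvinv : 0 < / v) by (apply Rinv_0_lt_compat; exact Hv0).
    assert (Hdk : / K ^ (4 * k) <= (INR (n - k) / M ^ 2) ^ k).
    { rewrite pow_mult, <- pow_inv. apply pow_incr; split; [|exact Hden].
      left; apply Rinv_0_lt_compat, pow_lt; lra. }
    replace mu with (INR B ^ 2 * (INR (n - k) / M ^ 2) ^ k * (1 - q) ^ n).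
    2:{ unfold mu, Rdiv; rewrite Rpow_mult_distr, pow_inv; ring. }
    assert (Hnk0 : 0 < INR n / K ^ 6) by (apply Rdiv_lt_0_compat; lra).
    (* Since [n = v^4] and [K^(4 k + 6) <= v], the product of the three factors is at least
       [v^2]. *)
    apply Rle_trans with (INR n / K ^ 6 * / K ^ (4 * k) * / v).
    - apply Rmult_le_reg_r with (K ^ (4 * k) * K ^ 6 * v);
        [apply Rmult_lt_0_compat; [apply Rmult_lt_0_compat|]; assumption|].
      replace (INR n / K ^ 6 * / K ^ (4 * k) * / v * (K ^ (4 * k) * K ^ 6 * v)) with (INR n)
        by (field; lra).
      rewrite Hh, Hhh.
      replace (v * v * (v * v)) with (v * (v * v * v)) by ring.
      apply Rmult_le_compat_l; [lra|].
      apply Rle_trans with (v * v); [apply Rmult_le_compat_r; lra|].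
      rewrite <- (Rmult_1_r (v * v)) at 1.
      apply Rmult_le_compat_l; [left; apply Rmult_lt_0_compat|]; assumption.
    - apply Rmult_le_compat; [left; apply Rmult_lt_0_compat; assumption|lra| |exact Hpow].
      apply Rmult_le_compat; lra. }
  apply prob_ge_weaken with (1 - 2 * K * q - 1 / mu).
  - assert (Hlv : l ^ 2 / 64 <= v).
    { replace (l ^ 2 / 64) with ((l / 4) ^ 2 / 4) by field. apply exp_ge_square; lra. }
    assert (Hlv' : l <= v).
    { apply Rle_trans with (2 := Hlv).
      replace (l ^ 2 / 64) with (l * (l / 64)) by field.
      rewrite <- (Rmult_1_r l) at 1; apply Rmult_le_compat_l; lra. }
    assert (Hinv : 1 / mu <= eps / 2).
    { apply Rle_trans with (1 / v).
      - apply Rmult_le_compat_l; [lra|]; apply Rinv_le_contravar; lra.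
      - apply Rmult_le_reg_r with v; [lra|].
        replace (1 / v * v) with 1 by (field; lra).
        apply Rle_trans with (eps / 2 * l); [lra|apply Rmult_le_compat_l; lra]. }
    assert (HKq : 2 * K * q <= eps / 2).
    { apply Rmult_le_reg_r with (8 * h); [lra|].
      apply Rle_trans with (2 * K).
      - replace (2 * K * q * (8 * h)) with (2 * K * (q * (h * 8))) by ring.
        rewrite <- (Rmult_1_r (2 * K)) at 2; apply Rmult_le_compat_l; lra.
      - apply Rle_trans with (eps / 2 * (8 * (l ^ 2 / 16))); [|apply Rmult_le_compat_l; lra].
        replace (eps / 2 * (8 * (l ^ 2 / 16))) with (l * eps * (l / 4)) by field.
        apply Rle_trans with (2304 * (l / 4)); [lra|apply Rmult_le_compat_r; lra]. }
    lra.
  - apply (occupied_probability n m k (2 * k ^ 3) B (polygon_box k) (lens_boxes k)).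
    + exact Hm0.
    + apply NoDup_nodup.
    + apply lens_boxes_window; exact Hk100.
    + intros i Hi; apply (in_lens_boxes k); exists i; split; [exact Hi|].
      apply polygon_box_in_lens; exact Hk100.
    + apply polygon_box_inj; exact Hk100.
    + unfold B; rewrite Nat.mul_comm; apply Nat.Div0.mul_div_le.
    + exact Hkn'.
    + exact Hq2.
    + apply Rlt_le_trans with v; [exact Hv0|exact Hmu].
    + intros c x _ Ho Hc; apply (polygon_block_evades k (2 * k ^ 3) n m r c x); try assumption.
      fold M; fold K; lra.
Qed.

Theorem theorem6 :
  exists K3 : R, 0 < K3 /\
    forall r : nat -> R,
      (forall n : nat, (2 <= n)%nat -> 0 < r n /\ r n <= K3 * ln (INR n) / sqrt (INR n)) ->
      forall eps : R, 0 < eps ->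
        exists N : nat, forall n : nat, (N <= n)%nat ->
          prob_ge n (fun x => cop_number_gt1 (vert n) (rgg_adj n x (r n))) (1 - eps).
Proof.
  exists (/ 600); split; [lra|].
  intros r Hr eps Heps.
  destruct (ln_eventually_ge (2304 / eps + 100000000)) as [N HN].
  exists N; intros n Hn.
  destruct (HN n Hn) as [H2 Hl]; destruct (Hr n H2) as [Hpos Hup].
  (* The ranges meet at [r] of order [sqrt (ln n / n)]. The threshold for [n] depends on [eps] only,
     so the case may change with [n]. *)
  destruct (Rle_lt_dec (8 * r n * sqrt (INR n / ln (INR n))) 1) as [Hsmall|Hlarge].
  - apply isolated_regime; assumption.
  - apply polygon_regime; assumption.
Qed.
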